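(* Let $\Gamma$ be a finite abelian group, $\Sigma=\mathbb{Z}_2=\langle\theta\rangle$, and $1\to\Sigma^*\to G\xrightarrow{\pi}\Gamma\to1$ a stem extension ($\Sigma^*\subset[G,G]\cap Z(G)$) with normalized section $s$ and 2-cocycle $\sigma$. Let $M=\bigoplus_{i\in I}M_i$ be an indecomposable Yetter-Drinfel'd module over $\Gamma$ with one-dimensional mutually non-isomorphic summands $M_i=x_i\mathbb{C}$, with $\mathcal{B}(M)$ finite-dimensional, with Cartan matrix $(C_{i,j})$, and on which $\Sigma$ acts as twisted permutation symmetries with respect to $\sigma$. Let $\tilde M=\bigoplus_{\tilde k\in\tilde I}\tilde M_{\tilde k}$ be the covering module, where $\tilde I$ is the set of $\Sigma$-orbits in $I$ and $\tilde M_{\tilde k}=\bigoplus_{k\in\tilde k}M_k$ are its simple summands, and let $(\tilde C_{\tilde k,\tilde l})$ be its Cartan matrix. Let $\tilde k\ne\tilde l\in\tilde I$. (1) (Disconnected) If every $k\in\tilde k$ is disconnected from every $l\in\tilde l$, i.e. $q_{kl}q_{lk}=1$ and $\mathrm{ad}(x_k)(x_l)=0$, then $\tilde C_{\tilde k,\tilde l}=0$, i.e. $\tilde k,\tilde l$ are disconnected in the diagram of $\tilde M$. (2) (Inert edge) If $\tilde k=\{k\}$ and $\tilde l=\{l\}$ are inert, then $\tilde C_{\tilde k,\tilde l}=C_{k,l}$. (3) (Split edge) Let $\tilde k=\{k_1,k_2\}$ and $\tilde l=\{l_1,l_2\}$ both be split and, after possible renumbering, let the Dynkin diagram of $\mathcal{B}(M)$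 restricted to $M_{k_1},M_{k_2},M_{l_1},M_{l_2}$ be of type $A_2\times A_2$, i.e. $\mathrm{ad}(M_{k_i})(M_{l_i})=:N_i\ne\{0\}$ for $i=1,2$ and all other ad-spaces are trivial. Then $\mathrm{ad}(\tilde M_{\tilde k})(\tilde M_{\tilde l})=N_1\oplus N_2\subset\mathcal{B}(\tilde M)$ and the Cartan matrix of $\tilde M$ restricted to $\tilde k,\tilde l$ is of type $A_2$: $$\begin{pmatrix}\tilde C_{\tilde k,\tilde k}&\tilde C_{\tilde k,\tilde l}\\ \tilde C_{\tilde l,\tilde k}&\tilde C_{\tilde l,\tilde l}\end{pmatrix}=\begin{pmatrix}2&-1\\-1&2\end{pmatrix}.$$ (4) (Ramified edge) Let $\tilde k=\{k_1,k_2\}$ be split and $\tilde l=\{l\}$ inert, and let the Dynkin diagram of $\mathcal{B}(M)$ restricted to $M_{k_1},M_{k_2},M_l$ be of type $A_3$ with $l$ the middle node, i.e. $\mathrm{ad}(M_{k_i})(M_l)=:N_i\neq\{0\}$ for $i=1,2$, $\mathrm{ad}(M_{k_2})(N_1)=\mathrm{ad}(M_{k_1})(N_2)=:N_{12}\ne\{0\}$, and all other ad-spaces are trivial. Then the Cartan matrix of $\tilde M$ restricted to $\tilde k,\tilde l$ is of type $B_2$ with the split node $\tilde k$ the shorter root: $$\begin{pmatrix}\tilde C_{\tilde k,\tilde k}&\tilde C_{\tilde k,\tilde l}\\ \tilde C_{\tilde l,\tilde k}&\tilde C_{\tilde l,\tilde l}\end{pmatrix}=\begin{pmatrix}2&-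2\\-1&2\end{pmatrix}.$$
   Context: All groups are finite; Yetter-Drinfel'd modules are finite-dimensional over $\mathbb{C}$. A Yetter-Drinfel'd module over $\Gamma$ is a $\Gamma$-graded vector space with a $\Gamma$-action such that $g.M_h=M_{ghg^{-1}}$; braiding $c(v\otimes w)=g.w\otimes v$ for $v\in M_g$. It is indecomposable if $\{g\mid M_g\ne0\}$ generates the group. For $\Gamma$ abelian, $M_i=x_i\mathbb{C}$ has degree $\bar g_i$ and character $\chi_i$, and $q_{ij}=\chi_j(\bar g_i)$. The Nichols algebra $\mathcal{B}(M)$ is the quotient of $T(M)$ by the largest homogeneous ideal in degrees $\ge2$ invariant under the skew derivations $\partial_k$ determined, for a homogeneous basis $e_k\in M_{g_k}$, by $\partial_k(1)=0$, $\partial_k(e_l)=\delta_{kl}$, $\partial_k(xy)=\partial_k(x)(g_k.y)+x\partial_k(y)$. The adjoint action is $\mathrm{ad}(x)(y)=x^{(1)}yS(x^{(2)})$; for $x\in M_g$ this is $\mathrm{ad}(x)(y)=xy-(g.y)x$. For subspaces, $\mathrm{ad}(N)(L)$ is the span of the $\mathrm{ad}(x)(y)$, $x\in N,y\in L$. For $\mathcal{B}(M)$ finite-dimensional and $M=\bigoplus_{i}M_i$ with $M_i$ simple, the Cartan matrix is $C_{i,i}=2$ and $C_{i,j}=-\max\{m\mid \mathrm{ad}^m(M_i)(M_j)\neq\{0\}\}$ for $i\ne j$ (corresponding to $C_{i,j}=2(\alpha_i,\alpha_j)/(\alpha_i,\alpha_i)$); the Dynkin diagram has the simple summands as nodes,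 with edges decorated by $(C_{i,j},C_{j,i})$. $\Sigma^*=\mathrm{Hom}(\Sigma,\mathbb{C}^\times)$; the section satisfies $s(1)=1$, $s(\bar g)s(\bar h)=\sigma(\bar g,\bar h)s(\bar g\bar h)$. $\Sigma$ acts on $M$ as twisted permutation symmetries with respect to $\sigma$ if there is an action of $\Sigma$ on $I$ such that $f_\theta(x_i)=x_{\theta.i}$ preserves the $\Gamma$-grading, commutes (as $f_\theta\otimes f_\theta$) with $c$ on each $M_i\otimes M_i$ and with $c^2$ on each $M_i\otimes M_j$, and satisfies $c(f_\theta\otimes f_\theta)=\langle\bar g_i,\bar g_j\rangle_\theta(f_\theta\otimes f_\theta)c$ on $M_i\otimes M_j$, where $\langle\bar g,\bar h\rangle_\theta=\sigma(\bar g,\bar h)(\theta)\sigma(\bar h,\bar g)(\theta)^{-1}$. Orbits of length 1 (resp. 2) in $I$ are called inert (resp. split). Covering module: $\tilde M=M$ as a vector space, with $G$ acting through $\pi$, and $\tilde M_h=\{v\in M_{\bar h}\mid f_p(v)=\lambda(p)v\ \forall p\in\Sigma\}$ with $\lambda=hs(\bar h)^{-1}\in\Sigma^*$, for $h\in G$, $\bar h=\pi(h)$. It is a Yetter-Drinfel'd module over $G$ and, when $\Gamma$ is a finite abelian group, $\Sigma=\mathbb{Z}_2$, $1\to\Sigma^*\to G\xrightarrow{\pi}\Gamma\to1$ is a stem extension with normalized section $s$ and 2-cocycle $\sigma$, and $M=\bigoplus_{i\in I}M_i$ is an indecomposable Yetter-Drinfel'd module over $\Gamma$ with one-dimensional mutually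 non-isomorphic summands $M_i$ on which $\Sigma$ acts as twisted permutation symmetries with respect to $\sigma$, its simple summands are the $\tilde M_{\tilde k}=\bigoplus_{k\in\tilde k}M_k$, where $\tilde k$ runs over the $\Sigma$-orbits in $I$. *)

(* Defs.v *)
From HB Require Import structures.
From mathcomp Require Import all_boot all_order ssralg ssrnum ssrint vector.
From mathcomp Require Import matrix fingroup morphism action commutator center.
From mathcomp Require Import generic_quotient ring_quotient finmap.
From mathcomp.multinomials Require Import monalg.
From mathcomp Require Import boolp classical_sets reals complex.

Set Implicit Arguments.
Unset Strict Implicit.
Unset Printing Implicit Defensive.

Import GRing.Theory.
Local Open Scope ring_scope.
Local Open Scope quotient_scope.

(* The tensor algebra T(V), modelled as the free associative algebra on the    *)
(* indices of [vbasis {:V}]; [word V [:: i1; i2; ...]] is b_i1 (x) b_i2 (x) ...,  *)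
(* [tens_in] is the inclusion of V = T^1(V), and [tens_ext] realizes the       *)
(* universal property.                                                         *)
Definition tensor (K : fieldType) (V : vectType K) : Type :=
  {malg K[{fmonom 'I_(\dim {:V})}]}.

HB.instance Definition _ (K : fieldType) (V : vectType K) :=
  GRing.Zmodule.on (tensor V).

Definition word (K : fieldType) (V : vectType K) (w : seq 'I_(\dim {:V})) :
  tensor V := << FMonom w >>.
Arguments word {K} V w.

(* The product and the scaling are those of [malg], locked so that unification *)
(* does not unfold them.                                                       *)
HB.lock Definition tens_mul (K : fieldType) (V : vectType K) (s t : tensor V) :
  tensor V := fgmul s t.

HB.lock Definition tens_scale (K : fieldType) (V : vectType K) (a : K)
  (t : tensor V) : tensor V := fgscale a t.

Section Tensor.
Variables (K : fieldType) (V : vectType K).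
Implicit Types (s t : tensor V) (u w : {fmonom 'I_(\dim {:V})}).

Local Notation mul := (@tens_mul K V).
Local Notation scale := (@tens_scale K V).
Local Notation one := (@fgone {fmonom 'I_(\dim {:V})} K : tensor V).

Lemma tens_mulA : associative mul.
Proof. rewrite tens_mul.unlock; exact: fgmulA. Qed.
Lemma tens_mul1 : left_id one mul.
Proof. rewrite tens_mul.unlock; exact: fgmul1g. Qed.
Lemma tens_1mul : right_id one mul.
Proof. rewrite tens_mul.unlock; exact: fgmulg1. Qed.
Lemma tens_mulDl : left_distributive mul +%R.
Proof. rewrite tens_mul.unlock; exact: fgmulgDl. Qed.
Lemma tens_mulDr : right_distributive mul +%R.
Proof. rewrite tens_mul.unlock; exact: fgmulgDr. Qed.
Lemma tens_one_neq0 : one != 0.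
Proof. exact: fgoner_eq0. Qed.

HB.instance Definition _ := GRing.Zmodule_isNzRing.Build (tensor V)
  tens_mulA tens_mul1 tens_1mul tens_mulDl tens_mulDr tens_one_neq0.

Lemma tens_scaleE a t w : (scale a t)@_w = a * t@_w.
Proof. by rewrite tens_scale.unlock fgscaleE. Qed.

Lemma tens_scaleA a b t : scale a (scale b t) = scale (a * b) t.
Proof. by apply/malgP => w; rewrite !tens_scaleE mulrA. Qed.
Lemma tens_scale1 : left_id 1 scale.
Proof. by move=> t; apply/malgP => w; rewrite tens_scaleE mul1r. Qed.
Lemma tens_scaleDr : right_distributive scale +%R.
Proof.
by move=> a s t; apply/malgP => w; rewrite !(mcoeffD, tens_scaleE) mulrDr.
Qed.
Lemma tens_scaleDl t : {morph scale^~ t : a b / a + b}.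
Proof.
by move=> a b; apply/malgP => w; rewrite !(mcoeffD, tens_scaleE) mulrDl.
Qed.

HB.instance Definition _ := GRing.Zmodule_isLmodule.Build K (tensor V)
  tens_scaleA tens_scale1 tens_scaleDr tens_scaleDl.

Lemma tcoeff0 w : (0 : tensor V)@_w = 0.
Proof. exact: mcoeff0. Qed.

Lemma tcoeffD s t w : (s + t)@_w = s@_w + t@_w.
Proof. exact: mcoeffD. Qed.

Lemma tcoeffZ (a : K) t w : (a *: t)@_w = a * t@_w.
Proof. exact: tens_scaleE. Qed.

Lemma tcoeff_sum (J : Type) (r : seq J) (P : pred J) (F : J -> tensor V) w :
  (\sum_(j <- r | P j) F j)@_w = \sum_(j <- r | P j) (F j)@_w.
Proof.
apply: (big_morph (fun t : tensor V => t@_w)); last exact: tcoeff0.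
by move=> s t; apply: tcoeffD.
Qed.

Lemma tcoeff_word u w : (word V (fmonom_val u))@_w = (u == w)%:R.
Proof. by rewrite /word fmK mcoeffU1. Qed.

Lemma tensor_sum_wordw (d : {fset _}) t : (msupp t `<=` d)%fset ->
  t = \sum_(w <- d) t@_w *: word V (fmonom_val w).
Proof.
move=> le; apply/malgP => w; rewrite tcoeff_sum.
under eq_bigr => u _ do rewrite tcoeffZ tcoeff_word.
have [wt|] := boolP (w \in msupp t).
  rewrite (big_fsetD1 w) ?(fsubsetP le) //= eqxx mulr1 big1_fset ?addr0 //= => u.
  by rewrite !inE => /andP[/negbTE-> _] _; rewrite mulr0.
move/mcoeff_outdom => t0; rewrite t0 big1 // => u _.
by case: eqP => [->|_]; rewrite ?t0 ?mul0r ?mulr0.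
Qed.

Lemma tensor_sum_word t : t = \sum_(w <- msupp t) t@_w *: word V (fmonom_val w).
Proof. exact: tensor_sum_wordw. Qed.

Lemma word_nil : word V [::] = 1.
Proof. by rewrite /word -fmoneE. Qed.

Lemma word_cat (v w : seq 'I_(\dim {:V})) : word V (v ++ w) = word V v * word V w.
Proof.
rewrite -[RHS]/(tens_mul _ _) tens_mul.unlock /word fgmulUU mulr1.
by rewrite /mmul /= fmmulE.
Qed.

Lemma word_prod (w : seq 'I_(\dim {:V})) : word V w = \prod_(i <- w) word V [:: i].
Proof.
elim: w => [|i w IH]; first by rewrite word_nil big_nil.
by rewrite -cat1s word_cat big_cons IH.
Qed.

Lemma tensor_scaleU (a : K) w : a *: word V (fmonom_val w) = << a *g w >>.
Proof.
apply/malgP => u; rewrite tcoeffZ tcoeff_word mcoeffU.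
by case: (w == u); rewrite ?mulr1 ?mulr0.
Qed.

Lemma tensor_mulEw (d d' : {fset _}) s t :
  (msupp s `<=` d)%fset -> (msupp t `<=` d')%fset ->
  s * t = \sum_(u <- d) \sum_(w <- d')
             (s@_u * t@_w) *: word V (fmonom_val u ++ fmonom_val w).
Proof.
move=> hs ht; rewrite -[LHS]/(tens_mul s t) tens_mul.unlock (fgmullw hs ht).
apply: eq_bigr => u _; apply: eq_bigr => w _.
by rewrite -[u ++ w]/(fmonom_val (FMonom _)) tensor_scaleU /mmul /= fmmulE.
Qed.

Lemma tensor_mulE s t :
  s * t = \sum_(u <- msupp s) \sum_(w <- msupp t)
             (s@_u * t@_w) *: word V (fmonom_val u ++ fmonom_val w).
Proof. exact: tensor_mulEw. Qed.

Lemma msupp_scale_le (a : K) t : (msupp (a *: t) `<=` msupp t)%fset.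
Proof.
by rewrite -[a *: t]/(tens_scale a t) tens_scale.unlock msuppZ_le.
Qed.

Lemma tensor_scalerAl (a : K) s t : a *: (s * t) = (a *: s) * t.
Proof.
rewrite (tensor_mulEw (msupp_scale_le a s) (fsubset_refl (msupp t))).
rewrite tensor_mulE scaler_sumr.
apply: eq_bigr => w _; rewrite scaler_sumr; apply: eq_bigr => w' _.
by rewrite scalerA tcoeffZ mulrA.
Qed.

HB.instance Definition _ :=
  GRing.Lmodule_isLalgebra.Build K (tensor V) tensor_scalerAl.

Lemma tensor_scalerAr (a : K) s t : a *: (s * t) = s * (a *: t).
Proof.
rewrite (tensor_mulEw (fsubset_refl (msupp s)) (msupp_scale_le a t)).
rewrite tensor_mulE scaler_sumr.
apply: eq_bigr => w _; rewrite scaler_sumr; apply: eq_bigr => w' _.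
by rewrite scalerA tcoeffZ mulrCA.
Qed.

HB.instance Definition _ :=
  GRing.Lalgebra_isAlgebra.Build K (tensor V) tensor_scalerAr.

End Tensor.

HB.lock Definition tens_in (K : fieldType) (V : vectType K) (v : V) : tensor V :=
  \sum_i coord (vbasis {:V}) i v *: word V [:: i].

HB.lock Definition tens_lin (K : fieldType) (V : vectType K) (A : lmodType K)
    (F : seq 'I_(\dim {:V}) -> A) (t : tensor V) : A :=
  \sum_(w <- msupp t) t@_w *: F (fmonom_val w).

Section LinearExtension.
Variables (K : fieldType) (V : vectType K) (A : lmodType K).
Variable F : seq 'I_(\dim {:V}) -> A.
Implicit Types (s t : tensor V).

Lemma tens_linw (d : {fset _}) t : (msupp t `<=` d)%fset ->
  tens_lin F t = \sum_(w <- d) t@_w *: F (fmonom_val w).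
Proof.
move=> le; rewrite tens_lin.unlock [LHS](big_fset_incl _ le) => //= x xd.
by move/mcoeff_outdom ->; rewrite scale0r.
Qed.

Lemma tens_lin_linear : linear (tens_lin F).
Proof.
move=> a s t.
pose d := (msupp s `|` msupp t)%fset.
have hs : (msupp s `<=` d)%fset by exact: fsubsetUl.
have ht : (msupp t `<=` d)%fset by exact: fsubsetUr.
have hst : (msupp (a *: s + t) `<=` d)%fset.
  apply: fsubset_trans (msuppD_le _ _) _.
  by rewrite fsubUset ht andbT (fsubset_trans (msupp_scale_le _ _)).
rewrite !(tens_linw hs, tens_linw ht, tens_linw hst) scaler_sumr -big_split /=.
by apply: eq_bigr => w _; rewrite tcoeffD tcoeffZ scalerDl scalerA.
Qed.

HB.instance Definition _ :=
  GRing.isLinear.Build K (tensor V) A _ (tens_lin F) tens_lin_linear.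

Lemma tens_lin_word w : tens_lin F (word V w) = F w.
Proof.
by rewrite (tens_linw msuppU_le) big_seq_fset1 mcoeffUU scale1r.
Qed.

End LinearExtension.

(* the extension of phi to T(V) as a morphism of algebras *)
Definition tens_ext (K : fieldType) (V : vectType K) (A : lalgType K)
    (phi : V -> A) : tensor V -> A :=
  tens_lin (fun w => \prod_(i <- w) phi (vbasis {:V})`_i).

Definition tens_map (K : fieldType) (V : vectType K) (f : V -> V) :
  tensor V -> tensor V := tens_ext (fun v => tens_in (f v)).

(* the component of degree n *)
Definition tens_part (K : fieldType) (V : vectType K) (n : nat) :
  tensor V -> tensor V :=
  tens_lin (fun w => if size w == n then word V w else 0).

HB.instance Definition _ (K : fieldType) (V : vectType K) (A : lalgType K)
    (phi : V -> A) := GRing.Linear.on (tens_ext phi).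
HB.instance Definition _ (K : fieldType) (V : vectType K) (n : nat) :=
  GRing.Linear.on (@tens_part K V n).

Section TensorTheory.
Variables (K : fieldType) (V : vectType K).
Implicit Types (s t : tensor V).

Lemma tens_part_word n w :
  tens_part n (word V w) = if size w == n then word V w else 0.
Proof. exact: tens_lin_word. Qed.

Lemma tens_partE n t w : (tens_part n t)@_w = if size w == n then t@_w else 0.
Proof.
transitivity (\sum_(u <- msupp t)
                 t@_u * (if size w == n then (u == w)%:R else 0)).
  rewrite {1}[t]tensor_sum_word linear_sum tcoeff_sum.
  apply: eq_bigr => u _; rewrite linearZ /= tens_part_word tcoeffZ.
  congr (_ * _); have [<-|ne] := eqVneq u w; last rewrite if_same.
    by case: ifP => _; rewrite ?tcoeff0 // tcoeff_word eqxx.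
  by case: ifP => _; rewrite ?tcoeff0 // tcoeff_word (negbTE ne).
case: ifP => _; last by rewrite big1 // => u _; rewrite mulr0.
rewrite [in RHS](tensor_sum_word t) tcoeff_sum; apply: eq_bigr => u _.
by rewrite tcoeffZ tcoeff_word.
Qed.

Lemma tens_in_linear : linear (@tens_in K V).
Proof.
move=> a u v; rewrite tens_in.unlock scaler_sumr -big_split /=.
by apply: eq_bigr => i _; rewrite linearP scalerDl scalerA.
Qed.

HB.instance Definition _ :=
  GRing.isLinear.Build K V (tensor V) _ (@tens_in K V) tens_in_linear.

Lemma tens_in_basis (i : 'I_(\dim {:V})) :
  tens_in (vbasis {:V})`_i = word V [:: i].
Proof.
have fb := basis_free (vbasisP {:V}).
rewrite tens_in.unlock (bigD1 i) //= coord_free // eqxx scale1r.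
rewrite big1 ?addr0 // => j /negbTE ji.
by rewrite coord_free // eq_sym ji scale0r.
Qed.

(* induction principle on linear combinations of words *)
Lemma tensor_lin_eq (A : lmodType K) (F F' : {linear tensor V -> A}) :
  (forall w, F (word V w) = F' (word V w)) -> F =1 F'.
Proof.
move=> FF' t; rewrite [t]tensor_sum_word !linear_sum.
by apply: eq_bigr => w _; rewrite !linearZ /= FF'.
Qed.

Lemma tens_ext_word (A : lalgType K) (phi : V -> A) w :
  tens_ext phi (word V w) = \prod_(i <- w) phi (vbasis {:V})`_i.
Proof. exact: tens_lin_word. Qed.

Lemma tens_ext_monoid (A : algType K) (phi : V -> A) :
  monoid_morphism (tens_ext phi).
Proof.
split; first by rewrite -(word_nil V) tens_ext_word big_nil.
move=> s t; rewrite tensor_mulE linear_sum.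
rewrite [in RHS](tensor_sum_word s) [in RHS](tensor_sum_word t).
rewrite !linear_sum mulr_suml; apply: eq_bigr => u _.
rewrite linear_sum mulr_sumr; apply: eq_bigr => w _.
rewrite !linearZ /= !tens_ext_word big_cat /=.
by rewrite -scalerAl -scalerAr scalerA.
Qed.

HB.instance Definition _ (A : algType K) (phi : V -> A) :=
  GRing.isMonoidMorphism.Build (tensor V) A (tens_ext phi)
    (tens_ext_monoid phi).

Lemma tens_ext_in (A : lalgType K) (phi : {linear V -> A}) v :
  tens_ext phi (tens_in v) = phi v.
Proof.
rewrite {2}(coord_vbasis (memvf v)) tens_in.unlock !linear_sum /=.
by apply: eq_bigr => i _; rewrite !linearZ /= tens_ext_word big_seq1.
Qed.

Lemma tens_ext_uniq (A : algType K) (F : {lrmorphism tensor V -> A}) t :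
  F t = tens_ext (fun v => F (tens_in v)) t.
Proof.
apply: (tensor_lin_eq (F' := tens_ext (fun v => F (tens_in v)))) => w /=.
rewrite tens_ext_word word_prod rmorph_prod.
by apply: eq_bigr => i _; rewrite tens_in_basis.
Qed.

End TensorTheory.

(* Data of a Yetter-Drinfel'd module: [ydact g] is the action of g and         *)
(* [yddeg h] is the graded piece M_h. The axioms are [is_yd].                  *)
Record yd (G : finGroupType) (K : fieldType) (V : vectType K) := Yd {
  ydact : G -> 'End(V);
  yddeg : G -> {vspace V}
}.

Section YetterDrinfeld.
Variables (G : finGroupType) (K : fieldType) (V : vectType K) (M : yd G V).

Record is_yd : Prop := IsYd {
  ydact1 : ydact M 1%g = \1%VF;
  ydactM : forall g h, ydact M (g * h)%g = (ydact M g \o ydact M h)%VF;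
  yd_direct : directv (\sum_(g : G) yddeg M g)%VS;
  yd_full : (\sum_(g : G) yddeg M g)%VS = fullv;
  ydactJ : forall g h,
    (ydact M g @: yddeg M h)%VS = yddeg M (g * h * g^-1)%g
}.

Definition yd_indecomposable : Prop :=
  <<[set g : G | yddeg M g != 0%VS]>>%g = [set: G]%SET.

(* the projection of V onto M_g along the other graded pieces *)
Definition ydproj (g : G) : 'End(V) :=
  sumv_pi (\sum_(h : G) yddeg M h)%VS g.

(* isomorphism of the Yetter-Drinfel'd submodules U and W of M *)
Definition yd_iso (U W : {vspace V}) : Prop :=
  exists phi : 'End(V),
  [/\ (phi @: U)%VS = W,
      (U :&: lker phi)%VS = 0%VS,
      forall g u, u \in U -> phi (ydact M g u) = ydact M g (phi u) &
      forall h, (phi @: (U :&: yddeg M h) <= yddeg M h)%VS].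

(* The braiding of M on V (x) V, seen as the degree 2 part of T(V); it is      *)
(* extended by 0 to the other degrees.                                         *)
Definition braiding (t : tensor V) : tensor V :=
  \sum_i \sum_j t@_(FMonom [:: i; j]) *:
    \sum_(g : G) tens_in (ydact M g (vbasis {:V})`_j) *
                 tens_in (ydproj g (vbasis {:V})`_i).

(* the diagonal action of g on T(V) *)
Definition tact (g : G) : tensor V -> tensor V := tens_map (ydact M g).

Definition homog_basis (n : nat) (e : n.-tuple V) (d : 'I_n -> G) : Prop :=
  basis_of fullv e /\ forall k, tnth e k \in yddeg M (d k).

(* D is the skew derivation partial_k of the homogeneous basis e; it exists by  *)
(* [skew_der_exists] and is unique since V generates T(V).                     *)
Record skew_der (n : nat) (e : n.-tuple V) (d : 'I_n -> G) (k : 'I_n)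
    (D : {linear tensor V -> tensor V}) : Prop := SkewDer {
  skew_der1 : D 1 = 0;
  skew_der_basis : forall l, D (tens_in (tnth e l)) = (k == l)%:R;
  skew_derM : forall s t, D (s * t) = D s * tact (d k) t + s * D t
}.

Record admissible_ideal (J : tensor V -> Prop) : Prop := AdmissibleIdeal {
  adm0 : J 0;
  admD : forall (a : K) s t, J s -> J t -> J (a *: s + t);
  admMl : forall s t, J t -> J (s * t);
  admMr : forall s t, J t -> J (t * s);
  adm_homog : forall n t, J t -> J (tens_part n t);
  adm_deg : forall n t, J t -> (n < 2)%N -> tens_part n t = 0;
  adm_der : forall n (e : n.-tuple V) d k D,
    homog_basis e d -> skew_der e d k D -> forall t, J t -> J (D t)
}.

(* the sum of all admissible ideals, see [nichols_ideal_adm] *)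
Definition nichols_ideal : {pred tensor V} :=
  [pred t | `[< exists J, admissible_ideal J /\ J t >]].

Lemma nichols_idealP t :
  reflect (exists J, admissible_ideal J /\ J t) (t \in nichols_ideal).
Proof. by apply: (iffP idP) => [/asboolP|/asboolP]. Qed.

Lemma nichols_ideal_adm : admissible_ideal (fun t => t \in nichols_ideal).
Proof.
split.
- apply/nichols_idealP; exists (fun t => t = 0); split=> //; split=> //.
  + by move=> a s t -> ->; rewrite scaler0 addr0.
  + by move=> s t ->; rewrite mulr0.
  + by move=> s t ->; rewrite mul0r.
  + by move=> n t ->; rewrite linear0.
  + by move=> n t ->; rewrite linear0.
  + by move=> n e d k D _ _ t ->; rewrite linear0.
- move=> a s t /nichols_idealP[J1 [A1 J1s]] /nichols_idealP[J2 [A2 J2t]].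
  apply/nichols_idealP.
  exists (fun u => exists u1 u2, [/\ J1 u1, J2 u2 & u = u1 + u2]).
  split; last first.
    exists (a *: s), t; split=> //.
    by rewrite -[_ *: _]addr0; apply: admD => //; apply: adm0.
  split.
  + by exists 0, 0; rewrite addr0; split=> //; apply: adm0.
  + move=> b _ _ [u1 [u2 [h1 h2 ->]]] [v1 [v2 [k1 k2 ->]]].
    exists (b *: u1 + v1), (b *: u2 + v2).
    by rewrite scalerDr addrACA; split=> //; apply: admD.
  + move=> u _ [u1 [u2 [h1 h2 ->]]]; exists (u * u1), (u * u2).
    by rewrite mulrDr; split=> //; apply: admMl.
  + move=> u _ [u1 [u2 [h1 h2 ->]]]; exists (u1 * u), (u2 * u).
    by rewrite mulrDl; split=> //; apply: admMr.
  + move=> n _ [u1 [u2 [h1 h2 ->]]].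
    exists (tens_part n u1), (tens_part n u2).
    by rewrite linearD; split=> //; apply: adm_homog.
  + move=> n _ [u1 [u2 [h1 h2 ->]]] n2.
    by rewrite linearD /= (adm_deg A1 h1 n2) (adm_deg A2 h2 n2) addr0.
  + move=> n e d k D he hD _ [u1 [u2 [h1 h2 ->]]]; exists (D u1), (D u2).
    by rewrite linearD; split=> //; [apply: (adm_der A1 he hD)
                                    |apply: (adm_der A2 he hD)].
- move=> s t /nichols_idealP[J [A Jt]]; apply/nichols_idealP; exists J.
  by split=> //; apply: admMl.
- move=> s t /nichols_idealP[J [A Jt]]; apply/nichols_idealP; exists J.
  by split=> //; apply: admMr.
- move=> n t /nichols_idealP[J [A Jt]]; apply/nichols_idealP; exists J.
  by split=> //; apply: adm_homog.
- by move=> n t /nichols_idealP[J [A Jt]]; apply: (adm_deg A).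
- move=> n e d k D he hD t /nichols_idealP[J [A Jt]].
  apply/nichols_idealP; exists J.
  by split=> //; apply: (adm_der A he hD).
Qed.

Lemma nichols_ideal_largest (J : tensor V -> Prop) :
  admissible_ideal J -> forall t, J t -> t \in nichols_ideal.
Proof. by move=> A t Jt; apply/nichols_idealP; exists J. Qed.

Lemma nichols_ideal_zmod : zmod_closed nichols_ideal.
Proof.
have A := nichols_ideal_adm; split; first exact: (adm0 A).
by move=> s t hs ht; rewrite addrC -scaleN1r; apply: (admD A).
Qed.

HB.instance Definition _ :=
  GRing.isZmodClosed.Build (tensor V) nichols_ideal nichols_ideal_zmod.

End YetterDrinfeld.

(* the Nichols algebra B(M) = T(V) / nichols_ideal M *)
Definition nichols (G : finGroupType) (K : fieldType) (V : vectType K)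
  (M : yd G V) : Type := Quotient.quot (nichols_ideal M).

HB.instance Definition _ (G : finGroupType) (K : fieldType) (V : vectType K)
  (M : yd G V) := GRing.Zmodule.on (nichols M).
HB.instance Definition _ (G : finGroupType) (K : fieldType) (V : vectType K)
  (M : yd G V) := EqQuotient.on (nichols M).
HB.instance Definition _ (G : finGroupType) (K : fieldType) (V : vectType K)
  (M : yd G V) := ZmodQuotient.on (nichols M).

HB.lock Definition nichols_pi (G : finGroupType) (K : fieldType)
  (V : vectType K) (M : yd G V) : tensor V -> nichols M := \pi_(nichols M).

HB.lock Definition nichols_mul (G : finGroupType) (K : fieldType)
    (V : vectType K) (M : yd G V) (x y : nichols M) : nichols M :=
  nichols_pi M (repr x * repr y).

HB.lock Definition nichols_scale (G : finGroupType) (K : fieldType)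
    (V : vectType K) (M : yd G V) (a : K) (x : nichols M) : nichols M :=
  nichols_pi M (a *: repr x).

Section NicholsAlgebra.
Variables (G : finGroupType) (K : fieldType) (V : vectType K) (M : yd G V).
Implicit Types (s t : tensor V) (x y z : nichols M).

Local Notation I := (nichols_ideal M).
Local Notation A := (nichols_ideal_adm M).

Local Notation pi := (nichols_pi M).

Lemma nichols_piP s t : reflect (pi s = pi t) (s - t \in I).
Proof.
rewrite nichols_pi.unlock -[_ \in _]/(Quotient.equiv I s t).
have -> : Quotient.equiv I s t = (s == t %[mod nichols M]) by rewrite piE.
exact: eqP.
Qed.

Lemma nichols_piK x : pi (repr x) = x.
Proof. by rewrite nichols_pi.unlock reprK. Qed.

Lemma nichols_repr s : repr (pi s) - s \in I.
Proof. by apply/nichols_piP; rewrite nichols_piK. Qed.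

Lemma nichols_piD s t : pi (s + t) = pi s + pi t.
Proof. rewrite nichols_pi.unlock; exact: (@Quotient.pi_add _ I). Qed.

Definition nichols_one : nichols M := pi 1.

Lemma nichols_mulE s t :
  nichols_mul (pi s) (pi t) = pi (s * t).
Proof.
rewrite nichols_mul.unlock; apply/nichols_piP; set s' := repr _; set t' := repr _.
have -> : s' * t' - s * t = (s' - s) * t' + s * (t' - t).
  by rewrite mulrBl mulrBr addrA subrK.
apply: rpredD; [apply: (admMr A) | apply: (admMl A)]; exact: nichols_repr.
Qed.

Lemma nichols_scaleE a s :
  nichols_scale a (pi s) = pi (a *: s).
Proof.
rewrite nichols_scale.unlock; apply/nichols_piP; rewrite -scalerBr -[X in X \in _]addr0.
apply: (admD A); last exact: (adm0 A).
exact: nichols_repr.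
Qed.

Lemma nichols_mulA : associative (@nichols_mul G K V M).
Proof.
move=> x y z; rewrite -(nichols_piK x) -(nichols_piK y) -(nichols_piK z).
by rewrite !nichols_mulE mulrA.
Qed.

Lemma nichols_mul1 : left_id nichols_one (@nichols_mul G K V M).
Proof. by move=> x; rewrite -(nichols_piK x) nichols_mulE mul1r. Qed.

Lemma nichols_1mul : right_id nichols_one (@nichols_mul G K V M).
Proof. by move=> x; rewrite -(nichols_piK x) nichols_mulE mulr1. Qed.

Lemma nichols_mulDl : left_distributive (@nichols_mul G K V M) +%R.
Proof.
move=> x y z; rewrite -(nichols_piK x) -(nichols_piK y) -(nichols_piK z).
by rewrite -nichols_piD !nichols_mulE mulrDl nichols_piD.
Qed.

Lemma nichols_mulDr : right_distributive (@nichols_mul G K V M) +%R.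
Proof.
move=> x y z; rewrite -(nichols_piK x) -(nichols_piK y) -(nichols_piK z).
by rewrite -nichols_piD !nichols_mulE mulrDr nichols_piD.
Qed.

Lemma nichols_one_neq0 : nichols_one != 0.
Proof.
apply/eqP => h1.
have : (1 : tensor V) - 0 \in I.
  apply/nichols_piP; rewrite -/nichols_one h1.
  by rewrite nichols_pi.unlock pi_zeror.
rewrite subr0 => /(adm_deg A)/(_ (isT : (0 < 2)%N))/malgP/(_ (FMonom [::])).
rewrite tens_partE /= -(word_nil V) tcoeff0 (tcoeff_word (FMonom [::])) eqxx.
by apply/eqP; rewrite oner_eq0.
Qed.

HB.instance Definition _ := GRing.Zmodule_isNzRing.Build (nichols M)
  nichols_mulA nichols_mul1 nichols_1mul nichols_mulDl nichols_mulDr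
  nichols_one_neq0.

Lemma nichols_scaleA a b x :
  nichols_scale a (nichols_scale b x) = nichols_scale (a * b) x.
Proof. by rewrite -(nichols_piK x) !nichols_scaleE scalerA. Qed.

Lemma nichols_scale1 : left_id 1 (@nichols_scale G K V M).
Proof. by move=> x; rewrite -(nichols_piK x) nichols_scaleE scale1r. Qed.

Lemma nichols_scaleDr : right_distributive (@nichols_scale G K V M) +%R.
Proof.
move=> a x y; rewrite -(nichols_piK x) -(nichols_piK y).
by rewrite -nichols_piD !nichols_scaleE scalerDr nichols_piD.
Qed.

Lemma nichols_scaleDl x : {morph (@nichols_scale G K V M)^~ x : a b / a + b}.
Proof.
move=> a b; rewrite -(nichols_piK x).
by rewrite !nichols_scaleE scalerDl nichols_piD.
Qed.

HB.instance Definition _ := GRing.Zmodule_isLmodule.Build K (nichols M)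
  nichols_scaleA nichols_scale1 nichols_scaleDr nichols_scaleDl.

Lemma nichols_scaleAl (a : K) x y : a *: (x * y) = (a *: x) * y.
Proof.
rewrite -[LHS]/(nichols_scale a (nichols_mul x y)).
rewrite -[RHS]/(nichols_mul (nichols_scale a x) y).
rewrite -(nichols_piK x) -(nichols_piK y).
by rewrite !(nichols_mulE, nichols_scaleE) scalerAl.
Qed.

HB.instance Definition _ := GRing.Lmodule_isLalgebra.Build K (nichols M)
  nichols_scaleAl.

Lemma nichols_scaleAr (a : K) x y : a *: (x * y) = x * (a *: y).
Proof.
rewrite -[LHS]/(nichols_scale a (nichols_mul x y)).
rewrite -[RHS]/(nichols_mul x (nichols_scale a y)).
rewrite -(nichols_piK x) -(nichols_piK y).
by rewrite !(nichols_mulE, nichols_scaleE) scalerAr.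
Qed.

HB.instance Definition _ := GRing.Lalgebra_isAlgebra.Build K (nichols M)
  nichols_scaleAr.

Lemma nichols_pi_linear : linear pi.
Proof.
move=> a s t; rewrite nichols_piD -[a *: pi s]/(nichols_scale _ _).
by rewrite nichols_scaleE.
Qed.

HB.instance Definition _ :=
  GRing.isLinear.Build K (tensor V) (nichols M) _ pi nichols_pi_linear.

Lemma nichols_pi_monoid : monoid_morphism pi.
Proof.
split; first by [].
by move=> s t; rewrite -nichols_mulE.
Qed.

HB.instance Definition _ :=
  GRing.isMonoidMorphism.Build (tensor V) (nichols M) pi
    nichols_pi_monoid.

End NicholsAlgebra.

Section AdjointAction.
Variables (G : finGroupType) (K : fieldType) (V : vectType K) (M : yd G V).
Implicit Types (N : {vspace V}) (L : set (nichols M)).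

(* The action of g on B(M); it does not depend on the representative when M   *)
(* is a Yetter-Drinfel'd module, see [nichols_act_pi].                         *)
Definition nichols_act (g : G) (y : nichols M) : nichols M :=
  nichols_pi M (tact M g (repr y)).

Definition nichols_in (v : V) : nichols M := nichols_pi M (tens_in v).

(* ad(x)(y) = xy - (g.y)x for x in M_g, extended linearly in x *)
Definition ad (x : V) (y : nichols M) : nichols M :=
  \sum_(g : G) (nichols_in (ydproj M g x) * y
                - nichols_act g y * nichols_in (ydproj M g x)).

Definition lspan (A : lmodType K) (S : set A) : set A :=
  [set a | exists (n : nat) (c : 'I_n -> K) (s : 'I_n -> A),
             (forall i, S (s i)) /\ a = \sum_i c i *: s i]%classic.

Definition nichols_im N : set (nichols M) :=
  [set y | exists2 v, v \in N & y = nichols_in v]%classic.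

(* ad(N)(L) and ad^m(N)(L) *)
Definition adsp N L : set (nichols M) :=
  lspan [set z | exists x y, [/\ x \in N, L y & z = ad x y]]%classic.

Definition adspn (m : nat) N L : set (nichols M) := iter m (adsp N) L.

Definition is_max_ad N N' (m : nat) : Prop :=
  adspn m N (nichols_im N') <> [set 0]%classic /\
  forall m', adspn m' N (nichols_im N') <> [set 0]%classic -> (m' <= m)%N.

(* The value 1, which is not an off-diagonal Cartan entry, is returned when    *)
(* there is no maximum; the maximum exists when B(M) is finite-dimensional.    *)
Definition cartan (I : eqType) (N : I -> {vspace V}) (i j : I) : int :=
  if i == j then 2 else
  xget 1 [set c : int | exists2 m : nat,
                          is_max_ad (N i) (N j) m & c = - m%:Z]%classic.

End AdjointAction.
Arguments nichols_im {G K V} M N _.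

Definition cartan_sub (I : Type) (C : I -> I -> int) (n : nat)
  (s : n.-tuple I) : 'M[int]_n := \matrix_(a, b) C (tnth s a) (tnth s b).

Definition mx_of_rows (n : nat) (rows : seq (seq int)) : 'M[int]_n :=
  \matrix_(a, b) nth 0 (nth [::] rows a) b.

Definition findim (K : fieldType) (A : lmodType K) : Prop :=
  exists (n : nat) (s : 'I_n -> A),
    forall a, exists c : 'I_n -> K, a = \sum_i c i *: s i.

(* Hom(S, K \ 0); the values are nonzero by multiplicativity *)
Definition is_dual (S : finGroupType) (K : fieldType) (c : {ffun S -> K}) :=
  (c 1%g == 1) && [forall p, forall q, c (p * q)%g == c p * c q].

Definition dual (S : finGroupType) (K : fieldType) :=
  {c : {ffun S -> K} | is_dual c}.

Definition dual_fun (S : finGroupType) (K : fieldType) (c : dual S K) : S -> K :=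
  val c.
Coercion dual_fun : dual >-> Funclass.

Lemma dual_mul_subproof (S : finGroupType) (K : fieldType) (c d : dual S K) :
  is_dual [ffun p => c p * d p].
Proof.
case/andP: (valP c) => /eqP c1 /forallP cM.
case/andP: (valP d) => /eqP d1 /forallP dM.
apply/andP; split; first by rewrite ffunE /dual_fun c1 d1 mul1r.
apply/forallP => p; apply/forallP => q; rewrite !ffunE /dual_fun.
have /forallP/(_ q)/eqP -> := cM p; have /forallP/(_ q)/eqP -> := dM p.
by rewrite mulrACA.
Qed.

Definition dual_mul (S : finGroupType) (K : fieldType) (c d : dual S K) :
  dual S K := Sub _ (dual_mul_subproof c d).

(* A stem extension 1 -> S^* -> G -> Gam -> 1 with a normalized section [ext_sec]  *)
(* and its 2-cocycle [ext_coc]; surjectivity of [ext_proj] follows from [ext_secK].        *)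
Record stem_ext (S Gam G : finGroupType) (K : fieldType) := StemExt {
  ext_inj : dual S K -> G;
  ext_proj : {morphism [set: G] >-> Gam};
  ext_sec : Gam -> G;
  ext_coc : Gam -> Gam -> dual S K;
  ext_inj_inj : injective ext_inj;
  ext_injM : forall c d, ext_inj (dual_mul c d) = (ext_inj c * ext_inj d)%g;
  ext_exact : forall h, ext_proj h = 1%g <-> exists c, ext_inj c = h;
  ext_stem : forall c,
    ext_inj c \in ([~: [set: G], [set: G]] :&: 'Z([set: G]))%g;
  ext_secK : forall g, ext_proj (ext_sec g) = g;
  ext_sec1 : ext_sec 1%g = 1%g;
  ext_cocE : forall g h, (ext_sec g * ext_sec h = ext_inj (ext_coc g h) * ext_sec (g * h))%g
}.

Section Covering.
Variables (S Gam G : finGroupType) (K : fieldType) (V : vectType K).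
Variables (E : stem_ext S Gam G K) (M : yd Gam V).

Lemma lam_subproof (h : G) : exists c, ext_inj E c = (h * (ext_sec E (ext_proj E h))^-1)%g.
Proof.
by apply/(ext_exact E); rewrite morphM ?inE // morphV ?inE // ext_secK mulgV.
Qed.

(* lambda = h s(pi h)^-1, seen in S^* *)
Definition lam (h : G) : dual S K := sval (cid (lam_subproof h)).

(* <g, h>_p *)
Definition twist (p : S) (g h : Gam) : K := ext_coc E g h p / ext_coc E h g p.

Definition covering (f : S -> 'End(V)) : yd G V := {|
  ydact h := ydact M (ext_proj E h);
  yddeg h := (yddeg M (ext_proj E h) :&:
              \bigcap_(p : S) lker (f p - lam h p *: \1%VF))%VS
|}.

(* x i spans M_i and has degree d i; the action [to] of S on I is a right      *)
(* action, which makes no difference for abelian S.                            *)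
Record twisted_symm (I : finType) (x : I -> V) (d : I -> Gam)
    (to : {action S &-> I}) (f : S -> 'End(V)) : Prop := TwistedSymm {
  symm_basis : forall p i, f p (x i) = x (to i p);
  symm_graded : forall p g, (f p @: yddeg M g <= yddeg M g)%VS;
  symm_braid : forall p i,
    let t := tens_in (x i) * tens_in (x i) in
    tens_map (f p) (braiding M t) = braiding M (tens_map (f p) t);
  symm_braid2 : forall p i j,
    let t := tens_in (x i) * tens_in (x j) in
    tens_map (f p) (braiding M (braiding M t)) =
      braiding M (braiding M (tens_map (f p) t));
  symm_twist : forall p i j,
    let t := tens_in (x i) * tens_in (x j) in
    braiding M (tens_map (f p) t) =
      twist p (d i) (d j) *: tens_map (f p) (braiding M t)
}.

End Covering.

HB.instance Definition _ (K : fieldType) (V : vectType K) (f : V -> V) :=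
  GRing.LRMorphism.on (tens_map f).

HB.instance Definition _ (G : finGroupType) (K : fieldType) (V : vectType K)
  (M : yd G V) (g : G) := GRing.LRMorphism.on (tact M g).

Section TensorMap.
Variables (K : fieldType) (V : vectType K).
Implicit Types (t : tensor V) (f : {linear V -> V}).

Lemma tens_map_in f v : tens_map f (tens_in v) = tens_in (f v).
Proof. exact: (tens_ext_in (@tens_in K V \o f)). Qed.

Lemma tens_map_comp f (h : {linear V -> V}) t :
  tens_map f (tens_map h t) = tens_map (f \o h) t.
Proof.
transitivity (tens_ext (fun v => tens_map f (tens_map h (tens_in v))) t).
  exact: (tens_ext_uniq (tens_map f \o tens_map h)).
rewrite [RHS]/tens_map; congr (tens_ext _ t); apply/funext => v.
by rewrite !tens_map_in.
Qed.

Lemma tens_part_in_mul n v t :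
  tens_part n (tens_in v * t) =
    if n is m.+1 then tens_in v * tens_part m t else 0.
Proof.
rewrite [t]tensor_sum_word mulr_sumr [LHS]linear_sum.
transitivity (\sum_(w <- msupp t) t@_w *:
  if n is m.+1 then tens_in v * tens_part m (word V (fmonom_val w)) else 0).
  apply: eq_bigr => w _; rewrite -scalerAr linearZ; congr (_ *: _) => /=.
  rewrite tens_in.unlock !mulr_suml linear_sum.
  transitivity (\sum_i coord (vbasis {:V}) i v *:
    if n is m.+1 then word V [:: i] * tens_part m (word V (fmonom_val w)) else 0).
    apply: eq_bigr => i _; rewrite -scalerAl linearZ; congr (_ *: _) => /=.
    rewrite -word_cat tens_part_word; case: n => [|m] //=.
    rewrite tens_part_word eqSS; case: ifP => _; rewrite ?mulr0 //.
    by rewrite -word_cat.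
  case: n => [|m]; first by rewrite big1 // => i _; rewrite scaler0.
  by rewrite mulr_suml; apply: eq_bigr => i _; rewrite scalerAl.
case: n => [|m]; first by rewrite big1 // => w _; rewrite scaler0.
rewrite linear_sum mulr_sumr; apply: eq_bigr => w _.
by rewrite linearZ scalerAr.
Qed.

Lemma tens_map_part f n t :
  tens_part n (tens_map f t) = tens_map f (tens_part n t).
Proof.
apply: (@tensor_lin_eq _ _ _ (tens_part n \o tens_map f)
                             (tens_map f \o tens_part n)) => w /=.
rewrite tens_part_word; elim: w n => [|i w IH] n.
  by rewrite word_nil rmorph1 -(word_nil V) tens_part_word; case: ifP;
     rewrite ?linear0 // word_nil rmorph1.
rewrite -cat1s word_cat -tens_in_basis rmorphM /= tens_map_in tens_part_in_mul.
case: n => [|n] /=; first by rewrite linear0.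
rewrite IH eqSS; case: ifP => _; last by rewrite !linear0 mulr0.
by rewrite rmorphM /= tens_map_in.
Qed.

End TensorMap.

Section Stable.
Variables (G : finGroupType) (K : fieldType) (V : vectType K) (M : yd G V).
Hypothesis ydM : is_yd M.

Lemma tact_in g v : tact M g (tens_in v) = tens_in (ydact M g v).
Proof. exact: tens_map_in. Qed.

Lemma tact_part g n t :
  tens_part n (tact M g t) = tact M g (tens_part n t).
Proof. exact: tens_map_part. Qed.

Lemma tact_add g s t : tact M g (s + t) = tact M g s + tact M g t.
Proof. exact: raddfD. Qed.

Lemma tact_mul g s t : tact M g (s * t) = tact M g s * tact M g t.
Proof. exact: rmorphM. Qed.

Lemma tactM g h t : tact M (g * h)%g t = tact M g (tact M h t).
Proof.
rewrite /tact tens_map_comp; congr (tens_map _ t).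
by apply/funext => v; rewrite (ydactM ydM) comp_lfunE.
Qed.

Lemma tact1 t : tact M 1%g t = t.
Proof.
transitivity (tens_ext (fun v => tens_in v) t); last first.
  exact: (esym (tens_ext_uniq idfun t)).
rewrite /tact /tens_map; congr (tens_ext _ t); apply/funext => v.
by rewrite (ydact1 ydM) id_lfunE.
Qed.

Lemma tactK g t : tact M g^-1%g (tact M g t) = t.
Proof. by rewrite -tactM mulVg tact1. Qed.

Lemma tactKV g t : tact M g (tact M g^-1%g t) = t.
Proof. by rewrite -tactM mulgV tact1. Qed.

Lemma nichols_ideal_act g t :
  t \in nichols_ideal M -> tact M g t \in nichols_ideal M.
Proof.
move=> ht; apply/nichols_idealP.
exists (fun u => tact M g^-1%g u \in nichols_ideal M).
split; last by rewrite tactK.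
have A := nichols_ideal_adm M; split.
- by rewrite linear0; apply: (adm0 A).
- by move=> a s u hs hu; rewrite linearP; apply: (admD A).
- by move=> s u hu; rewrite rmorphM; apply: (admMl A).
- by move=> s u hu; rewrite rmorphM; apply: (admMr A).
- by move=> n u hu; rewrite -tact_part; apply: (adm_homog A).
- move=> n u hu n2; rewrite -[tens_part n u](tactKV g).
  by rewrite -tact_part (adm_deg A hu n2) linear0.
- move=> n e d k D [eb ed] hD u hu.
  pose e' := [tuple of map (ydact M g^-1%g) e].
  pose d' k := (g^-1 * d k * g)%g.
  pose D' : {linear tensor V -> tensor V} := tact M g^-1%g \o D \o tact M g.
  have -> : tact M g^-1%g (D u) = D' (tact M g^-1%g u) by rewrite /= tactKV.
  apply: (adm_der A (e := e') (d := d') (k := k)) hu.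
    split.
      have gi : lker (ydact M g^-1%g) == 0%VS.
        apply/eqP/vspaceP => v; rewrite memv_ker memv0.
        apply/eqP/eqP => [/(congr1 (ydact M g))|->]; last by rewrite linear0.
        by rewrite -comp_lfunE -(ydactM ydM) mulgV (ydact1 ydM) id_lfunE linear0.
      have full : (ydact M g^-1%g @: fullv)%VS = fullv.
        by apply/eqP; rewrite eqEdim subvf limg_dim_eq ?leqnn //= (eqP gi) capv0.
      by rewrite -full; apply: limg_basis_of eb; rewrite (eqP gi) capv0.
    move=> l; have -> : d' l = (g^-1 * d l * g^-1^-1)%g by rewrite /d' invgK.
    rewrite tnth_map -(ydactJ ydM).
    exact: memv_img.
  split.
  + by rewrite /= rmorph1 (skew_der1 hD) linear0.
  + move=> l; rewrite /= tnth_map tact_in -comp_lfunE -(ydactM ydM) mulgV.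
    by rewrite (ydact1 ydM) id_lfunE (skew_der_basis hD) rmorph_nat.
  + move=> s s'.
    have E r : D' r = tact M g^-1%g (D (tact M g r)) by [].
    rewrite (E (s * s')) (tact_mul g s s') (skew_derM hD (tact M g s)).
    rewrite tact_add; congr (_ + _).
      by rewrite tact_mul /d' -(tactM (d k)) -tactM mulgA.
    by rewrite tact_mul (tactK g s).
Qed.

Lemma nichols_act_pi g t : nichols_act g (nichols_pi M t) = nichols_pi M (tact M g t).
Proof.
apply/nichols_piP; rewrite -linearB; apply: nichols_ideal_act.
exact: nichols_repr.
Qed.

End Stable.

Section SkewDerivation.
Variables (G : finGroupType) (K : fieldType) (V : vectType K) (M : yd G V).
Variables (n : nat) (e : n.-tuple V) (d : 'I_n -> G) (k : 'I_n).
Implicit Types (s t : tensor V).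

Fixpoint der_word (w : seq 'I_(\dim {:V})) : tensor V :=
  if w is i :: u then
    coord e k (vbasis {:V})`_i *: tact M (d k) (word V u)
      + word V [:: i] * der_word u
  else 0.

Lemma der_word_cat u w :
  der_word (u ++ w) =
    der_word u * tact M (d k) (word V w) + word V u * der_word w.
Proof.
elim: u => [|i u IH]; first by rewrite mul0r add0r word_nil mul1r.
rewrite [LHS]/= IH word_cat tact_mul.
rewrite [der_word (i :: u)]/= -[i :: u]cat1s word_cat.
by rewrite mulrDl [word V [:: i] * (_ + _)]mulrDr addrA -scalerAl !mulrA.
Qed.

Lemma skew_der_exists : basis_of fullv e ->
  exists D : {linear tensor V -> tensor V}, skew_der M e d k D.
Proof.
move=> eb; exists (tens_lin der_word); split.
- by rewrite -(word_nil V) /= tens_lin_word.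
- move=> l; have -> : (k == l)%:R = coord e k (tnth e l) *: 1 :> tensor V.
    rewrite (tnth_nth 0) coord_free ?(basis_free eb) // eq_sym.
    by case: (_ == _); rewrite ?scale1r ?scale0r.
  rewrite [in RHS](coord_vbasis (memvf (tnth e l))) tens_in.unlock.
  rewrite !linear_sum scaler_suml; apply: eq_bigr => i _.
  rewrite !linearZ /= tens_lin_word /= mulr0 addr0 word_nil.
  by rewrite rmorph1 scalerA.
- move=> s t.
  transitivity (\sum_(u <- msupp s) \sum_(w <- msupp t)
    (s@_u * t@_w) *: der_word (fmonom_val u ++ fmonom_val w)).
    rewrite tensor_mulE linear_sum.
    apply: eq_bigr => u _; rewrite linear_sum; apply: eq_bigr => w _.
    by rewrite linearZ /= tens_lin_word.
  transitivity (\sum_(u <- msupp s) \sum_(w <- msupp t)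
    ((s@_u *: der_word (fmonom_val u))
        * (t@_w *: tact M (d k) (word V (fmonom_val w)))
     + (s@_u *: word V (fmonom_val u)) * (t@_w *: der_word (fmonom_val w)))).
    apply: eq_bigr => u _; apply: eq_bigr => w _.
    by rewrite der_word_cat scalerDr -!scalerAl -!scalerAr !scalerA.
  under eq_bigr => u _ do rewrite big_split -!mulr_sumr.
  rewrite big_split -!mulr_suml /= -tensor_sum_word !tens_lin.unlock.
  congr (_ * _ + _).
  rewrite [t in RHS]tensor_sum_word linear_sum; apply: eq_bigr => w _.
  by rewrite linearZ.
Qed.

End SkewDerivation.

(* Main.v *)
From HB Require Import structures.
Require Import Defs.
From mathcomp Require Import all_boot all_order ssralg ssrnum ssrint vector.
From mathcomp Require Import matrix fingroup morphism action.
From mathcomp Require Import boolp classical_sets reals complex.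

Set Implicit Arguments.
Unset Strict Implicit.
Unset Printing Implicit Defensive.

Import GRing.Theory.
Local Open Scope ring_scope.

(* The grading of the covering module refines that of M, and G acts through     *)
(* pi, so both modules have the same skew derivations, hence the same Nichols   *)
(* algebra with the same adjoint action: the Cartan matrix of the covering      *)
(* module can be computed in B(M). There the braiding is diagonal and           *)
(* ad^m(M_A)(M_B) is spanned by the iterated brackets                           *)
(* ad(x_k1) ... ad(x_km)(x_l). As ad(x_i) is a skew derivation, it kills        *)
(* ad(x_j)(x_k) when it kills x_j and x_k; and ad(x_i), ad(x_j) commute up to a *)
(* scalar when x_i and x_j do. This bounds the number of non-vanishing brackets *)
(* by 1 in the split case and by 2 in the ramified one.                         *)

(** The covering module [Mt] has the space of M, its group acts through pi, and its piece of degree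
    h lies in the piece of M of degree pi(h). A skew derivation sees the degree of its basis vector
    only through the action, and the functional dual to a vector homogeneous for M is a combination
    of functionals dual to vectors homogeneous for [Mt] whose degrees have the same image in Gamma.
    So both modules have the same admissible ideals ([refine_admissible]), and their Nichols
    algebras are identified compatibly with ad and Cartan entries ([refine_ad], [refine_cartan]).
    That the finer pieces decompose V is an eigenspace decomposition under an involution
    ([covering_graded]).

    What remains is a computation in B(M) with sums of lines. By linearity ad^m(M_A)(M_B) vanishes
    once all brackets of m basis vectors of M_A with one of M_B vanish ([adspn_eq0]), and a Cartan
    entry follows from one nonzero bracket and the vanishing of all brackets one step longer
    ([is_max_adI]). The vanishing comes from the entries of C together with the product rule
    ([ad_ad_X0]) for split edges, and with commutation up to a scalar ([ad_comm]) for ramified ones.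
    The sum N_1 + N_2 is direct because a sign change on one basis vector separates the two lines
    ([adsp_lines_cap]). *)

Section Span.
Variables (K : fieldType) (A : lmodType K).
Implicit Types S P : set A.

(** Subspaces of a Nichols algebra are plain sets here; this is the subspace condition that the span
    inductions ask of a predicate. *)
Definition lclosed (P : A -> Prop) : Prop :=
  P 0 /\ forall a u v, P u -> P v -> P (a *: u + v).

Lemma lspan_mem S u : S u -> lspan S u.
Proof.
by move=> Su; exists 1%N, (fun=> 1), (fun=> u); rewrite big_ord1 scale1r.
Qed.

Lemma lspan_closed S : lclosed (lspan S).
Proof.
split=> [|a _ _ [n [c [s [hs ->]]]] [m [b [t [ht ->]]]]].
  by exists 0%N, (fun=> 0), (fun=> 0); split=> [[]//|]; rewrite big_ord0.
pose g (T : Type) (f : 'I_n -> T) (h : 'I_m -> T) (i : 'I_(n + m)) :=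
  match split i with inl j => f j | inr j => h j end.
exists (n + m)%N, (g _ (fun i => a * c i) b), (g _ s t); split=> [i|].
  by rewrite /g; case: split.
rewrite big_split_ord scaler_sumr /g; congr (_ + _); apply: eq_bigr => i _.
  by rewrite (unsplitK (inl i)) scalerA.
by rewrite (unsplitK (inr i)).
Qed.

Lemma lspan_ind S (P : A -> Prop) : lclosed P -> (forall u, S u -> P u) ->
  forall u, lspan S u -> P u.
Proof.
move=> [P0 PD] SP _ [n [c [s [hs ->]]]].
elim/big_ind: _ => // [u v Pu Pv|i _]; first by rewrite -[u]scale1r; apply: PD.
by rewrite -[X in P X]addr0; apply: PD => //; apply: SP.
Qed.

End Span.

(** * Gradings, separated from the action, and their homogeneous bases *)

Definition graded (G : finGroupType) (K : fieldType) (V : vectType K)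
  (M : yd G V) : Prop :=
  directv (\sum_(g : G) yddeg M g)%VS /\ (\sum_(g : G) yddeg M g)%VS = fullv.

Lemma is_yd_graded (G : finGroupType) (K : fieldType) (V : vectType K)
  (M : yd G V) : is_yd M -> graded M.
Proof. by case. Qed.

Section Graded.
Variables (G : finGroupType) (K : fieldType) (V : vectType K) (M : yd G V).
Hypothesis gM : graded M.

Lemma ydproj_mem g v : ydproj M g v \in yddeg M g.
Proof. exact: memv_sum_pi. Qed.

Lemma ydproj_sum v : \sum_(g : G) ydproj M g v = v.
Proof.
by apply: sumv_pi_sum; rewrite (gM.2) memvf.
Qed.

Lemma ydproj_deg g h v : v \in yddeg M g ->
  ydproj M h v = if h == g then v else 0.
Proof.
move=> vg; have [dM _] := gM.
(* The family concentrated at g is a second decomposition of v; directness identifies it with the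
   family of projections. *)
have E : \sum_(h : G) (if h == g then v else 0) = v.
  by rewrite -big_mkcond big_pred1_eq.
have /eqP := etrans (ydproj_sum v) (esym E).
rewrite (directv_sum_unique dM) => [/forallP/(_ h)/implyP/(_ isT)/eqP//|? _|i _].
  exact: ydproj_mem.
by case: eqP => [->//|_]; apply: mem0v.
Qed.

Lemma graded_ind (P : V -> Prop) :
  (forall u v, P u -> P v -> P (u + v)) -> P 0 ->
  (forall g v, v \in yddeg M g -> P v) -> forall v, P v.
Proof.
move=> PD P0 Pg v; rewrite -(ydproj_sum v).
by elim/big_ind: _ => // g _; apply: (Pg g); apply: ydproj_mem.
Qed.

Lemma homog_basis_exists : exists n (e : n.-tuple V) (d : 'I_n -> G),
  homog_basis M e d.
Proof.
have [dM fM] := gM.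
pose e := \big[cat/[::]]_(g : G) vbasis (yddeg M g).
have eb : basis_of fullv e.
  by rewrite -fM; apply: bigcat_basis => // g _; apply: vbasisP.
have em v : v \in e -> exists g, v \in yddeg M g.
  rewrite /e; elim/big_ind: _ => // [s t Hs Ht|g _ vg].
    by rewrite mem_cat => /orP[/Hs|/Ht].
  by exists g; apply: vbasis_mem.
have ek (k : 'I_(size e)) : exists g, e`_k \in yddeg M g.
  by apply: em; rewrite mem_nth.
exists (size e), (in_tuple e), (fun k => sval (cid (ek k))); split=> // k.
by case: cid => g /= ?; rewrite (tnth_nth 0).
Qed.

Lemma coord_deg n (e : n.-tuple V) d k g v : homog_basis M e d ->
  v \in yddeg M g -> g != d k -> coord e k v = 0.
Proof.
move=> [eb ed] vg gd; have fe := basis_free eb.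
have := ydproj_deg g vg; rewrite eqxx => <-.
rewrite {1}(coord_basis eb (memvf v)) linear_sum /=.
rewrite (eq_bigr (fun l =>
    (if g == d l then coord e l v else 0) *: e`_l)); last first.
  move=> l _; rewrite linearZ /= (ydproj_deg _ (g := d l)); last first.
    by rewrite -tnth_nth.
  by case: eqP; rewrite ?scaler0 ?scale0r.
by rewrite coord_sum_free // (negbTE gd).
Qed.

End Graded.

(** * Values of skew derivations on generators *)

Section SkewDerTheory.
Variables (G : finGroupType) (K : fieldType) (V : vectType K) (M : yd G V).
Variables (n : nat) (e : n.-tuple V) (d : 'I_n -> G) (k : 'I_n).
Variable D : {linear tensor V -> tensor V}.
Hypotheses (eb : basis_of fullv e) (hD : skew_der M e d k D).

Lemma skew_der_in v : D (tens_in v) = coord e k v *: 1.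
Proof.
rewrite {1}(coord_basis eb (memvf v)) !linear_sum /= (bigD1 k) //= big1 ?addr0.
  by rewrite !linearZ /= -tnth_nth (skew_der_basis hD) eqxx.
move=> l lk; rewrite !linearZ /= -tnth_nth (skew_der_basis hD).
by rewrite eq_sym (negbTE lk) scaler0.
Qed.

Lemma skew_der_in_mul v t :
  D (tens_in v * t) = coord e k v *: tact M (d k) t + tens_in v * D t.
Proof. by rewrite (skew_derM hD) skew_der_in -scalerAl mul1r. Qed.

End SkewDerTheory.

(** * The adjoint action and its linearity in the first argument *)

Section Adjoint.
Variables (G : finGroupType) (K : fieldType) (V : vectType K) (M : yd G V).
Implicit Types (N : {vspace V}) (L : set (nichols M)) (x : V) (y : nichols M).

Lemma nichols_in_linear : linear (nichols_in M).
Proof. by move=> a u v; rewrite /nichols_in !linearP. Qed.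
HB.instance Definition _ :=
  GRing.isLinear.Build K V (nichols M) _ (nichols_in M) nichols_in_linear.

Lemma adDl a u v y : ad (a *: u + v) y = a *: ad u y + ad v y.
Proof.
rewrite /ad scaler_sumr -big_split; apply: eq_bigr => g _ /=.
rewrite !linearP mulrDl mulrDr -scalerAl -scalerAr scalerBr opprD.
by rewrite addrACA.
Qed.

Lemma ad0l y : ad 0 y = 0.
Proof.
have := adDl (-1) 0 0 y.
by rewrite scaler0 addr0 scaleN1r addNr.
Qed.

Lemma adE g x y : graded M -> x \in yddeg M g ->
  ad x y = nichols_in M x * y - nichols_act g y * nichols_in M x.
Proof.
move=> gM xg; rewrite /ad (bigD1 g) //= big1 => [|h hg].
  by rewrite (ydproj_deg gM _ xg) eqxx addr0.
by rewrite (ydproj_deg gM _ xg) (negbTE hg) linear0 mulr0 mul0r subr0.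
Qed.

Lemma adsp_mem N L x y : x \in N -> L y -> adsp N L (ad x y).
Proof. by move=> Nx Ly; apply: lspan_mem; exists x, y. Qed.

Lemma adsp_ind N L (P : nichols M -> Prop) : lclosed P ->
  (forall x y, x \in N -> L y -> P (ad x y)) -> forall z, adsp N L z -> P z.
Proof. by move=> cP adP; apply: lspan_ind => // _ [x [y [? ? ->]]]; apply: adP. Qed.

Lemma set0_closed : lclosed [set 0 : nichols M]%classic.
Proof. by split=> // a u v -> ->; rewrite scaler0 addr0. Qed.

Lemma adsp_eq0 N L :
  (forall x y, x \in N -> L y -> ad x y = 0) -> adsp N L = [set 0]%classic.
Proof.
move=> ad0; apply/seteqP; split=> [|_ ->]; last exact: (lspan_closed _).1.
exact: adsp_ind set0_closed ad0.
Qed.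

End Adjoint.

(** * Refining the grading changes neither the Nichols algebra nor its adjoint action *)

Section Refinement.
Variables (G H : finGroupType) (K : fieldType) (V : vectType K).
Variables (M : yd G V) (M' : yd H V) (pi : H -> G).
Hypotheses (ydM : is_yd M) (gM' : graded M').
Hypothesis act' : forall h, ydact M' h = ydact M (pi h).
Hypothesis deg' : forall h, (yddeg M' h <= yddeg M (pi h))%VS.
Let gM := is_yd_graded ydM.

Lemma refine_tact h t : tact M' h t = tact M (pi h) t.
Proof. by rewrite /tact act'. Qed.

Lemma refine_homog n (e : n.-tuple V) d :
  homog_basis M' e d -> homog_basis M e (pi \o d).
Proof.
by move=> [eb ed]; split=> // k; apply: (subvP (deg' (d k))); apply: ed.
Qed.

Lemma refine_skew_der n (e : n.-tuple V) d k D :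
  skew_der M' e d k D -> skew_der M e (pi \o d) k D.
Proof. by case=> ? ? DM; split=> // s t; rewrite DM refine_tact. Qed.

(* The functional e_k^* is a combination of those e'_l^* for which e'_l has the *)
(* degree of e_k, and so is the associated skew derivation.                     *)
Lemma skew_der_change n (e : n.-tuple V) d k D n' (e' : n'.-tuple V) d'
    (D' : 'I_n' -> {linear tensor V -> tensor V}) t :
  homog_basis M e d -> skew_der M e d k D ->
  homog_basis M e' d' -> (forall l, skew_der M e' d' l (D' l)) ->
  D t = \sum_l coord e k (tnth e' l) *: D' l t.
Proof.
move=> he hD he' hD'; have [eb ed] := he; have [eb' ed'] := he'.
rewrite [t]tensor_sum_word linear_sum /=.
under [RHS]eq_bigr => l _ do rewrite linear_sum scaler_sumr.
rewrite exchange_big /=; apply: eq_bigr => w _.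
rewrite linearZ; under [RHS]eq_bigr => l _ do rewrite linearZ scalerA mulrC -scalerA.
rewrite -scaler_sumr; congr (_ *: _); move: (monalg.fmonom_val w) => {w t} w /=.
elim: w => [|i w IH].
  rewrite word_nil (skew_der1 hD) big1 // => l _.
  by rewrite (skew_der1 (hD' l)) scaler0.
rewrite -cat1s word_cat -tens_in_basis; set v := _`_i.
rewrite (skew_der_in_mul eb hD) IH mulr_sumr.
under [RHS]eq_bigr => l _ do
  rewrite (skew_der_in_mul eb' (hD' l)) scalerDr scalerAr scalerA.
rewrite big_split /=; congr (_ + _).
rewrite {1}(coord_basis eb' (memvf v)) linear_sum scaler_suml.
apply: eq_bigr => l _; rewrite linearZ /= -tnth_nth mulrC.
have [<-//|ne] := eqVneq (d' l) (d k).
by rewrite (coord_deg gM he (ed' l) ne) !mul0r !scale0r.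
Qed.

(** Only stability under skew derivations involves the grading. Those of [M'] are among those of
    [M], and by [skew_der_change] each one of [M] is a combination of those of a fixed basis
    homogeneous for [M']. *)
Lemma refine_admissible J : admissible_ideal M J <-> admissible_ideal M' J.
Proof.
split=> -[A0 AD Al Ar Ah Ag Ader]; split=> // n e d k D he hD.
  by apply: (Ader _ e (pi \o d) k D); [apply: refine_homog|apply: refine_skew_der].
have [n' [e' [d' he']]] := homog_basis_exists gM'.
have eb' := he'.1.
pose D' l := sval (cid (skew_der_exists M' d' l eb')).
have hD' l : skew_der M' e' d' l (D' l) by rewrite /D'; case: cid.
move=> t Jt; rewrite (skew_der_change t he hD (refine_homog he')
  (fun l => refine_skew_der (hD' l))).
elim/big_ind: _ => // [u v Ju Jv|l _]; first by rewrite -[u]scale1r; apply: AD.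
by rewrite -[X in J X]addr0; apply: AD => //; apply: (Ader _ _ _ _ _ he' (hD' l)).
Qed.

Lemma refine_ideal t : (t \in nichols_ideal M') = (t \in nichols_ideal M).
Proof.
by apply/nichols_idealP/nichols_idealP => -[J [A Jt]]; exists J; split=> //;
  apply/refine_admissible.
Qed.

(** The identity of T(V) passed to the quotients: the two ideals have the same elements, but the
    quotients are different types. *)
Definition refine_map (y : nichols M) : nichols M' :=
  nichols_pi M' (generic_quotient.repr y).

Lemma refine_map_pi t : refine_map (nichols_pi M t) = nichols_pi M' t.
Proof.
by apply/nichols_piP; rewrite refine_ideal; apply/nichols_piP; rewrite nichols_piK.
Qed.

Lemma refine_map_linear : linear refine_map.
Proof.
move=> a y z; rewrite -(nichols_piK y) -(nichols_piK z).
by rewrite -linearP !refine_map_pi linearP.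
Qed.

Lemma refine_map_monoid : monoid_morphism refine_map.
Proof.
split; first exact: (refine_map_pi 1).
move=> y z; rewrite -(nichols_piK y) -(nichols_piK z).
by rewrite -rmorphM !refine_map_pi rmorphM.
Qed.

HB.instance Definition _ :=
  GRing.isLinear.Build K (nichols M) (nichols M') _ refine_map refine_map_linear.
HB.instance Definition _ :=
  GRing.isMonoidMorphism.Build (nichols M) (nichols M') refine_map
    refine_map_monoid.

Lemma refine_map_bij : bijective refine_map.
Proof.
exists (fun z => nichols_pi M (generic_quotient.repr z)).
  move=> y; rewrite -[RHS]nichols_piK; apply/nichols_piP.
  by rewrite -refine_ideal; apply/nichols_piP; rewrite nichols_piK.
by move=> z; rewrite refine_map_pi nichols_piK.
Qed.

Lemma refine_map_in v : refine_map (nichols_in M v) = nichols_in M' v.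
Proof. exact: refine_map_pi. Qed.

Lemma refine_act h y :
  nichols_act h (refine_map y) = refine_map (nichols_act (pi h) y).
Proof.
rewrite refine_map_pi /nichols_act refine_tact; apply/nichols_piP.
rewrite refine_ideal -linearB; apply: nichols_ideal_act => //.
by rewrite -refine_ideal; apply: nichols_repr.
Qed.

(** By linearity x may be taken homogeneous for the finer grading, hence for the coarser one; then
    [adE] applies on both sides and [refine_act] compares the actions. *)
Lemma refine_ad x y : refine_map (ad x y) = ad x (refine_map y).
Proof.
move: x; apply: (graded_ind gM') => [u v Pu Pv||h x xh].
- by rewrite -[u]scale1r !adDl linearP /= Pu Pv.
- by rewrite !ad0l linear0.
- rewrite (adE _ gM' xh) (adE _ gM (subvP (deg' h) _ xh)).
  by rewrite linearB !rmorphM /= !refine_map_in refine_act.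
Qed.

Lemma refine_im N : nichols_im M' N = [set refine_map y | y in nichols_im M N]%classic.
Proof.
apply/seteqP; split=> [_ [v Nv ->]|_ [_ [v Nv ->] <-]].
  by exists (nichols_in M v); [exists v|exact: refine_map_in].
by exists v => //; rewrite refine_map_in.
Qed.

Lemma refine_adsp N L :
  adsp N (refine_map @` L)%classic = [set refine_map y | y in adsp N L]%classic.
Proof.
apply/seteqP; split=> [|_ [z zN <-]].
  apply: adsp_ind => [|x _ Nx [y Ly <-]].
    have [l0 lD] := lspan_closed
      [set z | exists x y, [/\ x \in N, L y & z = ad x y]]%classic.
    split; first by exists 0 => //; rewrite linear0.
    move=> a _ _ [u Lu <-] [v Lv <-]; exists (a *: u + v); first exact: lD.
    by rewrite linearP.
  by exists (ad x y); [apply: adsp_mem|rewrite refine_ad].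
move: z zN; apply: adsp_ind => [|x y Nx Ly].
  have [l0 lD] := lspan_closed
    [set z | exists x y, [/\ x \in N, (refine_map @` L)%classic y & z = ad x y]]%classic.
  by split=> [|a u v hu hv]; rewrite ?linear0 // linearP; apply: lD.
by rewrite refine_ad; apply: adsp_mem => //; exists y.
Qed.

Lemma refine_adspn m N L :
  adspn m N (refine_map @` L)%classic = [set refine_map y | y in adspn m N L]%classic.
Proof.
elim: m => [//|m IH]; rewrite /adspn !iterS.
by rewrite -/(adspn m N _) IH refine_adsp.
Qed.

Lemma refine_image_eq0 (L : set (nichols M)) :
  (refine_map @` L = [set 0]%classic)%classic <-> L = [set 0]%classic.
Proof.
have inj := bij_inj refine_map_bij.
split=> [E|->]; last by rewrite image_set1 linear0.
apply/seteqP; split=> [y Ly|_ ->].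
  have : (refine_map @` L)%classic (refine_map y) by exists y.
  by rewrite E => /= /eqP; rewrite -(linear0 refine_map) => /eqP/inj.
have : [set 0]%classic (0 : nichols M') by [].
by rewrite -E => -[y Ly y0]; rewrite -(inj y 0) // y0 linear0.
Qed.

Lemma refine_is_max_ad N N' m : is_max_ad M' N N' m <-> is_max_ad M N N' m.
Proof.
have E m' : adspn m' N (nichols_im M' N') <> [set 0]%classic <->
    adspn m' N (nichols_im M N') <> [set 0]%classic.
  by rewrite refine_im refine_adspn; split=> h /refine_image_eq0.
by split=> -[h1 h2]; split=> [|m' h]; try exact/E; apply: h2; apply/E.
Qed.

Lemma refine_lrmorphism : exists Phi : {lrmorphism nichols M -> nichols M'},
  [/\ bijective Phi, forall v, Phi (nichols_in M v) = nichols_in M' v &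
      forall N N', adsp N (nichols_im M' N') =
                   [set Phi y | y in adsp N (nichols_im M N')]%classic].
Proof.
exists refine_map; split; [exact: refine_map_bij|exact: refine_map_in|].
by move=> N N'; rewrite refine_im refine_adsp.
Qed.

Lemma refine_cartan (I : eqType) (N : I -> {vspace V}) i j :
  cartan M' N i j = cartan M N i j.
Proof.
rewrite /cartan; case: eqP => // _; congr (xget _ _).
by apply/seteqP; split=> c [m hm ->]; exists m => //; apply/refine_is_max_ad.
Qed.

End Refinement.

(** * Characters of Z_2 and the grading of the covering module *)

Lemma dual1 (S : finGroupType) (K : fieldType) (c : dual S K) : c 1%g = 1.
Proof. by case/andP: (valP c) => /eqP. Qed.

Lemma dualM (S : finGroupType) (K : fieldType) (c : dual S K) p q :
  c (p * q)%g = c p * c q.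
Proof. by case/andP: (valP c) => _ /forallP/(_ p)/forallP/(_ q)/eqP. Qed.

Section CoveringGraded.
Variables (S Gam G : finGroupType) (K : fieldType) (V : vectType K).
Variables (E : stem_ext S Gam G K) (M : yd Gam V) (f : S -> 'End(V)).
Hypotheses (S2 : #|[set: S]| = 2%N) (K2 : (2%:R : K) != 0).
Hypothesis ydM : is_yd M.
Hypotheses (f1 : forall v, f 1%g v = v) (ff : forall p v, f p (f p v) = v).
Hypothesis f_graded : forall p g, (f p @: yddeg M g <= yddeg M g)%VS.

(** With [ext_proj_sec] and [lam_sec] this parametrizes G by pairs of a character of Sigma and an
    element of Gamma. *)
Lemma lamE h : h = (ext_inj E (lam E h) * ext_sec E (ext_proj E h))%g.
Proof. by rewrite /lam; case: cid => c /= ->; rewrite mulgKV. Qed.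

Lemma ext_proj_sec c g : ext_proj E (ext_inj E c * ext_sec E g)%g = g.
Proof.
rewrite morphM ?inE // ext_secK.
by have /(ext_exact E) -> : exists c', ext_inj E c' = ext_inj E c;
  [exists c|rewrite mul1g].
Qed.

Lemma lam_sec c g : lam E (ext_inj E c * ext_sec E g)%g = c.
Proof.
apply: (ext_inj_inj (s := E)); apply: (mulIg (ext_sec E g)).
by rewrite [RHS]lamE ext_proj_sec.
Qed.

Lemma covering_mem h v :
  reflect (v \in yddeg M (ext_proj E h) /\ forall p, f p v = lam E h p *: v)
          (v \in yddeg (covering E M f) h).
Proof.
apply: (iffP idP) => /=.
  rewrite memv_cap => /andP[-> hv]; split=> // p.
  move: hv; rewrite memvE => /subv_bigcapP/(_ p isT); rewrite -memvE.
  rewrite memv_ker add_lfunE opp_lfunE scale_lfunE id_lfunE subr_eq0.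
  by move/eqP.
case=> vg hv; rewrite memv_cap vg /= memvE.
apply/subv_bigcapP => p _; rewrite -memvE memv_ker.
by rewrite add_lfunE opp_lfunE scale_lfunE id_lfunE subr_eq0 hv.
Qed.

Lemma Z2_generator : exists2 t : S, t != 1%g & forall p, p != 1%g -> p = t.
Proof.
have : #|[set~ (1%g : S)]| = 1%N by rewrite cardsC1 -cardsT S2.
case/eqP/cards1P => t Et; exists t => [|p].
  by have := set11 t; rewrite -Et !inE.
by move=> p1; apply/set1P; rewrite -Et !inE.
Qed.

Lemma Z2_sqr (p : S) : (p * p = 1)%g.
Proof.
have [t t1 tP] := Z2_generator; have [->|p1] := eqVneq p 1%g; first exact: mulg1.
apply/eqP/negPn/negP => pp1; move: (tP _ pp1).
rewrite -(tP _ p1) => /(congr1 (mulg p^-1)).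
by rewrite mulKg mulVg => p1'; rewrite p1' eqxx in p1.
Qed.

Lemma Z2_sign : exists c : dual S K, forall p, c p = if p == 1%g then 1 else -1.
Proof.
have [t t1 tP] := Z2_generator.
have hc : is_dual [ffun p : S => if p == 1%g then 1 else -1 : K].
  apply/andP; split; first by rewrite ffunE eqxx.
  apply/forallP => p; apply/forallP => q; rewrite !ffunE.
  have [->|p1] := eqVneq p 1%g; first by rewrite mul1g mul1r.
  have [->|q1] := eqVneq q 1%g; first by rewrite mulg1 (negbTE p1) mulr1.
  by rewrite (tP _ p1) (tP _ q1) Z2_sqr eqxx mulrNN mulr1.
by exists (Sub _ hc) => p; rewrite /dual_fun SubK ffunE.
Qed.

Lemma Z2_triv : exists c : dual S K, forall p, c p = 1.
Proof.
have hc : is_dual [ffun p : S => 1 : K].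
  apply/andP; split; first by rewrite ffunE.
  by apply/forallP => p; apply/forallP => q; rewrite !ffunE mulr1.
by exists (Sub _ hc) => p; rewrite /dual_fun SubK ffunE.
Qed.

Lemma Z2_dual_sqr (c : dual S K) p : c p * c p = 1.
Proof. by rewrite -dualM Z2_sqr dual1. Qed.

(** An h over g amounts to a character of Z_2, i.e. a sign, so the pieces over g are the two
    eigenspaces of the involution [f t] on M_g; they decompose M_g since 2 is invertible. *)
Lemma covering_graded : graded (covering E M f).
Proof.
have [t t1 tP] := Z2_generator; have gM := is_yd_graded ydM.
split.
  apply/directv_sum_independent => u hu u0 h0 _.
  have uP h := covering_mem h (u h) (hu h isT).
  (* On M_g0, P is twice the projection onto the piece of degree h0. *)
  pose g0 := ext_proj E h0; pose P v := v + lam E h0 t *: f t v.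
  have : P (ydproj M g0 (\sum_h u h)) = 0.
    by rewrite u0 /P !linear0 addr0.
  rewrite /P !linear_sum -big_split /= (bigD1 h0) //= big1.
    have [ug uf] := uP h0; rewrite addr0 (ydproj_deg gM _ ug) eqxx uf scalerA.
    rewrite Z2_dual_sqr scale1r -mulr2n -scaler_nat => /eqP.
    by rewrite scaler_eq0 (negbTE K2) => /eqP.
  move=> h hh0; have [ug uf] := uP h; rewrite (ydproj_deg gM _ ug).
  case: eqP => [eg|_]; last by rewrite !linear0 addr0.
  rewrite uf scalerA.
  (* A character is determined by its value at t, so equal signs would give h = h0. Opposite signs
     have product -1, and P kills [u h]. *)
  have [el|nl] := eqVneq (lam E h t) (lam E h0 t).
    case/negP: hh0; rewrite (lamE h) (lamE h0) -/g0 eg; apply/eqP; congr (_ * _)%g.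
    congr (ext_inj E _); apply/val_inj/ffunP => p.
    by have [->|/tP->] := eqVneq p 1%g; [rewrite -!/(dual_fun _ _) !dual1|].
  suff -> : lam E h0 t * lam E h t = -1 by rewrite scaleN1r subrr.
  have := Z2_dual_sqr (lam E h) t; rewrite -(Z2_dual_sqr (lam E h0) t) -!expr2.
  move/eqP; rewrite eqf_sqr (negbTE nl) => /eqP ->.
  by rewrite mulrN -expr2.
apply/eqP; rewrite eqEsubv subvf /=; apply/subvP => v _; move: v.
apply: (graded_ind gM) => [u v|| g v vg]; [exact: memvD|exact: mem0v|].
have [c0 c0P] := Z2_triv; have [c1 c1P] := Z2_sign.
have fv : f t v \in yddeg M g by apply: (subvP (f_graded t g)); apply: memv_img.
(* The parts of v belonging to the trivial and to the sign character. *)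
have -> : v = 2%:R^-1 *: (v + f t v) + 2%:R^-1 *: (v - f t v).
  by rewrite -scalerDr addrACA subrr addr0 -mulr2n -scaler_nat scalerA mulVf ?scale1r.
have mem (c : dual S K) (w : V) : w \in yddeg M g -> (forall p, f p w = c p *: w) ->
    w \in (\sum_h yddeg (covering E M f) h)%VS.
  move=> wg wf; rewrite memvE.
  apply: (sumv_sup (ext_inj E c * ext_sec E g)%g) => //; rewrite -memvE.
  by apply/covering_mem; rewrite ext_proj_sec lam_sec.
apply: memvD; apply: memvZ.
  apply: (mem c0) => [|p]; first exact: memvD.
  rewrite c0P scale1r; have [->|/tP->] := eqVneq p 1%g; first exact: f1.
  by rewrite linearD /= ff addrC.
apply: (mem c1) => [|p]; first exact: memvB.
rewrite c1P; have [->|] := eqVneq p 1%g; first by rewrite f1 scale1r.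
by move=> /tP->; rewrite linearB /= ff scaleN1r opprB.
Qed.

End CoveringGraded.

(** * Action, skew derivations and involutive symmetries on B(M) *)

Section NicholsTheory.
Variables (G : finGroupType) (K : fieldType) (V : vectType K) (M : yd G V).
Hypothesis ydM : is_yd M.
Implicit Types (y z : nichols M).

Lemma nichols_actD g a y z :
  nichols_act g (a *: y + z) = a *: nichols_act g y + nichols_act g z.
Proof.
rewrite -(nichols_piK y) -(nichols_piK z) -linearP !(nichols_act_pi ydM).
by rewrite /tact !linearP.
Qed.

Lemma nichols_actM g y z :
  nichols_act g (y * z) = nichols_act g y * nichols_act g z.
Proof.
rewrite -(nichols_piK y) -(nichols_piK z) -rmorphM !(nichols_act_pi ydM).
by rewrite tact_mul rmorphM.
Qed.

Lemma nichols_act_act g h y :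
  nichols_act (g * h)%g y = nichols_act g (nichols_act h y).
Proof.
by rewrite -(nichols_piK y) !(nichols_act_pi ydM) (tactM ydM).
Qed.

Lemma nichols_act_in g v : nichols_act g (nichols_in M v) = nichols_in M (ydact M g v).
Proof. by rewrite (nichols_act_pi ydM) tact_in. Qed.

Lemma adDr v a y z : ad v (a *: y + z) = a *: ad v y + ad v z.
Proof.
rewrite /ad scaler_sumr -big_split; apply: eq_bigr => g _ /=.
rewrite nichols_actD mulrDl mulrDr -scalerAl -scalerAr scalerBr opprD.
by rewrite addrACA.
Qed.

Lemma ad0r v : ad v (0 : nichols M) = 0.
Proof.
have := adDr v (-1) 0 0.
by rewrite scaler0 addr0 scaleN1r addNr.
Qed.

Lemma nichols_pi_eq0 t : (nichols_pi M t = 0) <-> t \in nichols_ideal M.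
Proof.
rewrite -[t in t \in _]subr0; split=> [h|/nichols_piP->]; last exact: linear0.
by apply/nichols_piP; rewrite h linear0.
Qed.

(** Skew derivations descend to B(M), which is how elements of B(M) are shown to be nonzero. *)
Lemma nichols_der n (e : n.-tuple V) d k D t : homog_basis M e d ->
  skew_der M e d k D -> nichols_pi M t = 0 -> nichols_pi M (D t) = 0.
Proof.
move=> he hD /nichols_pi_eq0 t0; apply/nichols_pi_eq0.
exact: (adm_der (nichols_ideal_adm M) he hD t0).
Qed.

(** The preimage of the ideal under T(phi) is admissible: conjugating a skew derivation of the basis
    e by T(phi) gives one of the basis phi(e), with the same degrees. *)
Lemma nichols_invol_ideal (phi : 'End(V)) t :
  (forall v, phi (phi v) = v) ->
  (forall g v, phi (ydact M g v) = ydact M g (phi v)) ->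
  (forall g v, v \in yddeg M g -> phi v \in yddeg M g) ->
  t \in nichols_ideal M -> tens_map phi t \in nichols_ideal M.
Proof.
move=> phiK phi_act phi_deg ht; apply/nichols_idealP.
have phiTK u : tens_map phi (tens_map phi u) = u.
  rewrite tens_map_comp; transitivity (tens_map idfun u).
    by rewrite /tens_map; congr (tens_ext _ u); apply/funext => v /=; rewrite phiK.
  exact: (esym (tens_ext_uniq idfun u)).
have phiTA g u : tens_map phi (tact M g u) = tact M g (tens_map phi u).
  rewrite /tact !tens_map_comp; congr (tens_map _ u).
  by apply/funext => v /=; rewrite phi_act.
exists (fun u => tens_map phi u \in nichols_ideal M); split; last by rewrite phiTK.
have A := nichols_ideal_adm M; split.
- by rewrite linear0; apply: (adm0 A).
- by move=> a s u hs hu; rewrite linearP; apply: (admD A).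
- by move=> s u hu; rewrite rmorphM; apply: (admMl A).
- by move=> s u hu; rewrite rmorphM; apply: (admMr A).
- by move=> n u hu; rewrite -tens_map_part; apply: (adm_homog A).
- move=> n u hu n2; rewrite -[tens_part n u]phiTK.
  by rewrite -tens_map_part (adm_deg A hu n2) linear0.
- move=> n e d k D [eb ed] hD u hu.
  pose D' : {linear tensor V -> tensor V} := tens_map phi \o D \o tens_map phi.
  have -> : tens_map phi (D u) = D' (tens_map phi u) by rewrite /= phiTK.
  apply: (adm_der A (e := [tuple of map phi e]) (d := d) (k := k)) hu.
    split; last by move=> l; rewrite tnth_map; apply: phi_deg.
    have k0 : lker phi = 0%VS.
      apply/eqP; rewrite -subv0; apply/subvP => v.
      by rewrite memv_ker memv0 => /eqP v0; rewrite -[v]phiK v0 linear0.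
    have full : (phi @: fullv)%VS = fullv.
      by apply/eqP; rewrite eqEdim subvf limg_dim_eq ?leqnn //= k0 capv0.
    by rewrite -full; apply: limg_basis_of eb; rewrite k0 capv0.
  split.
  + by rewrite /= rmorph1 (skew_der1 hD) linear0.
  + move=> l; rewrite /= tnth_map tens_map_in /= phiK.
    by rewrite (skew_der_basis hD) rmorph_nat.
  + move=> s s'.
    rewrite -[D' (s * s')]/(tens_map phi (D (tens_map phi (s * s')))).
    rewrite -[D' s]/(tens_map phi (D (tens_map phi s))).
    rewrite -[D' s']/(tens_map phi (D (tens_map phi s'))).
    rewrite rmorphM /= (skew_derM hD) linearD /= !rmorphM /=.
    by rewrite phiTA !phiTK.
Qed.

End NicholsTheory.

(** * Cartan entries as maxima *)

Section Cartan.
Variables (G : finGroupType) (K : fieldType) (V : vectType K) (M : yd G V).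
Variables (I : eqType) (N : I -> {vspace V}) (i j : I).
Hypothesis ij : i != j.

Lemma is_max_ad_cartan m : is_max_ad M (N i) (N j) m -> cartan M N i j = - m%:Z.
Proof.
move=> hm; rewrite /cartan (negbTE ij); apply: xget_unique; first by exists m.
move=> _ [m' hm' ->]; congr (- Posz _); apply/eqP; rewrite eqn_leq.
by apply/andP; split; [apply: hm.2; apply: hm'.1|apply: hm'.2; apply: hm.1].
Qed.

(** The default value 1 of [xget] is not of the form -m, so an entry known to be -m certifies that
    the maximum exists. *)
Lemma cartan_is_max_ad m : cartan M N i j = - m%:Z -> is_max_ad M (N i) (N j) m.
Proof.
rewrite /cartan (negbTE ij); case: xgetP => [c _ [m' hm' ->] /oppr_inj[<-//]|_].
by case: m.
Qed.

End Cartan.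

Lemma cartan_sub_entry (I : Type) (C : I -> I -> int) n (s : n.-tuple I) rows a b :
  cartan_sub C s = mx_of_rows n rows ->
  C (tnth s a) (tnth s b) = nth 0 (nth [::] rows a) b.
Proof. by move/matrixP/(_ a b); rewrite !mxE. Qed.

(** * Iterated brackets for a diagonal braiding *)

Section Diagonal.
Variables (Gam : finGroupType) (K : fieldType) (V : vectType K) (M : yd Gam V).
Variables (I : finType) (x : I -> V) (gb : I -> Gam) (chi : I -> Gam -> K).
Hypotheses (Gam_abelian : abelian [set: Gam]) (ydM : is_yd M).
Hypothesis x_basis : basis_of fullv (codom x).
Hypothesis x_deg : forall i, x i \in yddeg M (gb i).
Hypothesis x_act : forall i g, ydact M g (x i) = chi i g *: x i.
Implicit Types (i j k l : I) (y z : nichols M).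

Local Notation X i := (nichols_in M (x i)).
Local Notation q i j := (chi j (gb i)).
Local Notation S A := (\sum_(k in (A : {set I})) <[x k]>)%VS.

Lemma span_ind (A : {set I}) (P : V -> Prop) : lclosed P ->
  (forall k, k \in A -> P (x k)) -> forall v, v \in S A -> P v.
Proof.
move=> [P0 PD] Px v /memv_sumP[u hu ->].
elim/big_ind: _ => // [u1 u2 P1 P2|k kA]; first by rewrite -[u1]scale1r; apply: PD.
have /vlineP[a ->] := hu k kA; rewrite -[z in P z]addr0.
by apply: PD => //; apply: Px.
Qed.

Lemma span_mem (A : {set I}) k : k \in A -> x k \in S A.
Proof. by move=> kA; rewrite memvE; apply: (sumv_sup k). Qed.

Lemma x_basis_ind (P : V -> Prop) : lclosed P -> (forall i, P (x i)) ->
  forall v, P v.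
Proof.
move=> cP Px v; suff: v \in S [set: I] by apply: span_ind.
apply: (subvP _ v (memvf v)); rewrite -(span_basis x_basis).
by apply/span_subvP => _ /codomP[i ->]; apply: span_mem.
Qed.

(** The skew derivation dual to x_j, with [enum_rank] translating between I and positions in the
    basis. *)
Lemma diagonal_der j : exists D : {linear tensor V -> tensor V},
  [/\ forall t, nichols_pi M t = 0 -> nichols_pi M (D t) = 0,
      forall i t, D (tens_in (x i) * t) =
                  (i == j)%:R *: tact M (gb j) t + tens_in (x i) * D t &
      forall i, D (tens_in (x i)) = (i == j)%:R *: 1].
Proof.
pose e := [tuple of codom x].
have ei (i : I) : e`_(enum_rank i) = x i by rewrite nth_codom enum_rankK.
have eb : basis_of fullv e by [].
pose d (k : 'I_#|I|) := gb (enum_val k).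
have he : homog_basis M e d.
  by split=> // k; rewrite (tnth_nth 0) -(enum_valK k) ei /d enum_rankK.
have [D hD] := skew_der_exists M d (enum_rank j) eb.
have ce i : coord e (enum_rank j) (x i) = (i == j)%:R.
  by rewrite -ei coord_free ?(basis_free eb) // (inj_eq enum_rank_inj).
exists D; split=> [t|i t|i]; first exact: nichols_der he hD.
  by rewrite (skew_der_in_mul eb hD) ce /d enum_rankK.
by rewrite (skew_der_in eb hD) ce.
Qed.

Lemma X_neq0 i : X i != 0.
Proof.
have [D [D0 _ Din]] := diagonal_der i.
apply/eqP => /D0; rewrite Din eqxx scale1r rmorph1.
by apply/eqP; apply: oner_neq0.
Qed.

Lemma XX_neq0 i j : i != j -> X i * X j != 0.
Proof.
move=> ij; have [D [D0 DM Din]] := diagonal_der j.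
apply/eqP => h; have /eqP[] := X_neq0 i.
(* The derivation dual to x_j sends x_i x_j to x_i. *)
have := D0 (tens_in (x i) * tens_in (x j)); rewrite rmorphM => /(_ h).
by rewrite DM Din eqxx (negbTE ij) scale0r scale1r add0r mulr1.
Qed.

Lemma ad_x i y : ad (x i) y = X i * y - nichols_act (gb i) y * X i.
Proof. exact: adE (is_yd_graded ydM) (x_deg i). Qed.

Lemma act_X g i : nichols_act g (X i) = chi i g *: X i.
Proof. by rewrite (nichols_act_in ydM) x_act linearZ. Qed.

Lemma ad_X i j : ad (x i) (X j) = X i * X j - q i j *: (X j * X i).
Proof. by rewrite ad_x act_X scalerAl. Qed.

(** The two terms (g_i.y) x_i z on the right cancel. *)
Lemma ad_mul i y z :
  ad (x i) (y * z) = ad (x i) y * z + nichols_act (gb i) y * ad (x i) z.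
Proof.
rewrite !ad_x (nichols_actM ydM) mulrBl mulrBr !mulrA addrA.
by rewrite -[_ - _ + _]addrA addNr addr0.
Qed.

(** The relation x_i x_j = q_ij x_j x_i can be inverted using q_ij q_ji = 1. *)
Lemma ad_X_sym i j : q i j * q j i = 1 -> ad (x i) (X j) = 0 -> ad (x j) (X i) = 0.
Proof.
rewrite !ad_X => qq /eqP; rewrite subr_eq0 => /eqP ->.
by rewrite scalerA mulrC qq scale1r subrr.
Qed.

(** Using both relations, x_i x_j = q_ij q_ji x_i x_j, and this product is nonzero. *)
Lemma ad_X_qq i j : i != j -> ad (x i) (X j) = 0 -> ad (x j) (X i) = 0 ->
  q i j * q j i = 1.
Proof.
move=> ij; rewrite !ad_X => /eqP; rewrite subr_eq0 => /eqP Eij.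
move/eqP; rewrite subr_eq0 => /eqP Eji.
have /eqP := Eij; rewrite Eji scalerA -subr_eq0 -[Z in Z - _]scale1r -scalerBl.
by rewrite scaler_eq0 (negbTE (XX_neq0 ij)) orbF subr_eq0 => /eqP.
Qed.

(** Expand ad(x_j)(y) and apply the product rule: ad(x_i) passes x_j at the cost of q_ij. In the
    other summand g_j passes ad(x_i) at the cost of q_ji, Gamma being abelian, and q_ij q_ji = 1
    matches the scalars. *)
Lemma ad_comm i j y : i != j -> ad (x i) (X j) = 0 -> ad (x j) (X i) = 0 ->
  ad (x i) (ad (x j) y) = q i j *: ad (x j) (ad (x i) y).
Proof.
move=> ij Aij Aji; have qq := ad_X_qq ij Aij Aji.
have adg : nichols_act (gb j) (ad (x i) y) = q j i *: ad (x i) (nichols_act (gb j) y).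
  rewrite !ad_x -scaleN1r addrC (nichols_actD ydM) !(nichols_actM ydM) act_X.
  rewrite scaleN1r addrC scalerBr scalerAl scalerAr.
  by rewrite -!(nichols_act_act ydM) (centsP Gam_abelian) ?inE.
rewrite [ad (x j) y]ad_x -scaleN1r addrC (adDr ydM) !ad_mul Aij mulr0 mul0r.
rewrite addr0 add0r act_X [in RHS]ad_x adg scalerBr scaleN1r addrC.
by rewrite -!scalerAl scalerA qq scale1r.
Qed.

Fixpoint adw (ks : seq I) (y : nichols M) : nichols M :=
  if ks is k :: ks' then ad (x k) (adw ks' y) else y.

Lemma adw_cat ks ks' y : adw (ks ++ ks') y = adw ks (adw ks' y).
Proof. by elim: ks => //= k ks ->. Qed.

Lemma adw0 ks : adw ks 0 = 0.
Proof. by elim: ks => //= k ks ->; rewrite (ad0r ydM). Qed.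

Lemma adspn_mem (A B : {set I}) ks l :
  {subset ks <= A} -> l \in B ->
  adspn (size ks) (S A) (nichols_im M (S B)) (adw ks (X l)).
Proof.
move=> + lB; elim: ks => [|k ks IH] hk; first by exists (x l) => //; apply: span_mem.
apply: adsp_mem; first by apply: span_mem; apply: hk; rewrite mem_head.
by apply: IH => k' hk'; apply: hk; rewrite inE hk' orbT.
Qed.

(** By linearity of ad in both arguments, ad^m is spanned by the brackets of basis vectors. *)
Lemma adspn_ind m (A B : {set I}) (P : nichols M -> Prop) : lclosed P ->
  (forall ks l, size ks = m -> {subset ks <= A} -> l \in B -> P (adw ks (X l))) ->
  forall z, adspn m (S A) (nichols_im M (S B)) z -> P z.
Proof.
elim: m P => [|m IH] P cP hP z.
  case=> v vB ->; move: v vB; apply: span_ind => [|l lB]; last exact: (hP [::]).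
  have [P0 PD] := cP; split=> [|a u v Pu Pv]; first by rewrite linear0.
  by rewrite linearP; apply: PD.
have [P0 PD] := cP.
move: z; apply: adsp_ind => // v y + yA; move: v; apply: span_ind => [|k kA].
  by split=> [|a u v Pu Pv]; [rewrite ad0l|rewrite adDl; apply: PD].
move: y yA; apply: IH => [|ks l sk ka lB].
  by split=> [|a u v Pu Pv]; [rewrite (ad0r ydM)|rewrite (adDr ydM); apply: PD].
apply: (hP (k :: ks) l); rewrite /= ?sk // => k'.
by rewrite inE => /predU1P[->|/ka].
Qed.

Lemma adspn_eq0 m (A B : {set I}) :
  (forall ks l, size ks = m -> {subset ks <= A} -> l \in B -> adw ks (X l) = 0) ->
  adspn m (S A) (nichols_im M (S B)) = [set 0]%classic.
Proof.
move=> h0; apply/seteqP; split=> [|_ ->].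
  by apply: adspn_ind; [exact: set0_closed|].
(* For m = 0 the set is the image of a subspace, not an [lspan]. *)
case: m h0 => [|m] _; last exact: (lspan_closed _).1.
by exists 0; rewrite ?mem0v // linear0.
Qed.

(** A longer bracket has one of length [(size ks).+1] as its innermost part, so vanishing in this
    single length suffices. *)
Lemma is_max_adI (A B : {set I}) ks l :
  {subset ks <= A} -> l \in B -> adw ks (X l) <> 0 ->
  (forall ks' l', size ks' = (size ks).+1 -> {subset ks' <= A} -> l' \in B ->
     adw ks' (X l') = 0) ->
  is_max_ad M (S A) (S B) (size ks).
Proof.
move=> kA lB n0 h0; split.
  by move=> E; have := adspn_mem kA lB; rewrite E.
move=> m; apply: contra_notP => /negP; rewrite -ltnNge => lt.
apply: adspn_eq0 => ks' l' sk kA' lB'.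
rewrite -(cat_take_drop (m - (size ks).+1) ks') adw_cat h0 ?adw0 //.
  by rewrite size_drop sk subKn.
by move=> k /mem_drop/kA'.
Qed.

(** For two lines the only bracket of a given length is a power of ad(x_k) applied to x_l. *)
Lemma is_max_adE k l m : is_max_ad M <[x k]>%VS <[x l]>%VS m ->
  adw (nseq m k) (X l) <> 0 /\ adw (nseq m.+1 k) (X l) = 0.
Proof.
have E i : <[x i]>%VS = S [set i] by rewrite big_set1.
have ks1 ks : {subset ks <= [set k]} -> ks = nseq (size ks) k.
  by move=> h; apply/all_pred1P/allP => i /h; rewrite inE.
rewrite !E => -[h1 h2]; split.
  move=> h; apply: h1; apply: adspn_eq0 => ks l' sk /ks1 ->.
  by rewrite inE sk => /eqP ->.
apply: contrapT => n0.
suff /h2 : adspn m.+1 (S [set k]) (nichols_im M (S [set l])) <> [set 0]%classic.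
  by rewrite ltnn.
move=> E0; have := @adspn_mem [set k] [set l] (nseq m.+1 k) l.
rewrite size_nseq E0 => h; apply: n0; apply: h; rewrite ?set11 // => i.
by rewrite mem_nseq => /andP[_ /eqP->]; rewrite set11.
Qed.

Lemma is_max_ad_disconnected (A B : {set I}) l : l \in B ->
  (forall k l, k \in A -> l \in B -> ad (x k) (X l) = 0) ->
  is_max_ad M (S A) (S B) 0.
Proof.
move=> lB h0; apply: (@is_max_adI A B [::] l) => //; first exact/eqP/X_neq0.
by case=> [|k []] //= l' _ kA lB'; apply: h0 => //; apply: kA; rewrite mem_head.
Qed.

Lemma is_max_ad_simple (A B : {set I}) k l : k \in A -> l \in B ->
  ad (x k) (X l) <> 0 ->
  (forall k k' l, k \in A -> k' \in A -> l \in B -> ad (x k) (ad (x k') (X l)) = 0) ->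
  is_max_ad M (S A) (S B) 1.
Proof.
move=> kA lB n0 h0; apply: (@is_max_adI A B [:: k] l) => //.
  by move=> i; rewrite inE => /eqP->.
case=> [|i [|j []]] //= l' _ kA' lB'.
by apply: h0 => //; apply: kA'; rewrite !inE eqxx ?orbT.
Qed.

(** The inner bracket is a combination of products of x_j and x_k, which [ad_mul] sends to zero. *)
Lemma ad_ad_X0 i j k :
  ad (x i) (X j) = 0 -> ad (x i) (X k) = 0 -> ad (x i) (ad (x j) (X k)) = 0.
Proof.
move=> hj hk; rewrite ad_X -scaleNr addrC (adDr ydM) !ad_mul hj hk.
by rewrite !mul0r !mulr0 !addr0 scaler0.
Qed.

(** A bracket of length two vanishes if its inner pair is crossed; if it is not, a repeated outer
    letter is excluded by hypothesis and the other letter by [ad_ad_X0]. *)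
Lemma is_max_ad_split k1 k2 l1 l2 :
  ad (x k1) (X k2) = 0 -> ad (x k2) (X k1) = 0 ->
  ad (x k1) (X l2) = 0 -> ad (x k2) (X l1) = 0 ->
  ad (x k1) (ad (x k1) (X l1)) = 0 -> ad (x k2) (ad (x k2) (X l2)) = 0 ->
  ad (x k1) (X l1) <> 0 ->
  is_max_ad M (S [set k1; k2]) (S [set l1; l2]) 1.
Proof.
move=> k12 k21 k1l2 k2l1 h1 h2 n0.
apply: (@is_max_ad_simple _ _ k1 l1); rewrite ?set21 //.
move=> k k' l /set2P[]-> /set2P[]-> /set2P[]->;
  by rewrite ?h1 ?h2 ?k1l2 ?k2l1 ?(ad0r ydM) // ad_ad_X0.
Qed.

(** Of three letters from k1, k2 one is repeated; [ad_comm] moves two of its occurrences next to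
    x_l, up to a scalar, where they give zero. *)
Lemma is_max_ad_ramified k1 k2 l : k1 != k2 ->
  ad (x k1) (X k2) = 0 -> ad (x k2) (X k1) = 0 ->
  ad (x k1) (ad (x k1) (X l)) = 0 -> ad (x k2) (ad (x k2) (X l)) = 0 ->
  ad (x k2) (ad (x k1) (X l)) <> 0 ->
  is_max_ad M (S [set k1; k2]) (S [set l]) 2.
Proof.
move=> k12 c12 c21 h1 h2 n0.
apply: (@is_max_adI _ _ [:: k2; k1] l); rewrite ?set11 //.
  by move=> i; rewrite !inE orbC.
have C12 y := ad_comm y k12 c12 c21.
have C21 : forall y, ad (x k2) (ad (x k1) y) = q k2 k1 *: ad (x k1) (ad (x k2) y).
  by move=> y; apply: ad_comm => //; rewrite eq_sym.
have adZ i a y : ad (x i) (a *: y) = a *: ad (x i) y.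
  by rewrite -[a *: y]addr0 (adDr ydM) (ad0r ydM) addr0.
case=> [|k [|k' [|k'' []]]] //= l' _ hk /set1P ->.
have mk i : i \in [:: k; k'; k''] -> i = k1 \/ i = k2 by move/hk/set2P.
move: (mk k) (mk k') (mk k''); rewrite !inE !eqxx !orbT.
move=> /(_ isT)[] -> /(_ isT)[] -> /(_ isT)[] ->; rewrite ?h1 ?h2 ?(ad0r ydM) //.
(* Left are the four words whose two innermost letters differ. *)
- by rewrite C12 adZ C12 h1 (ad0r ydM) !scaler0.
- by rewrite C12 h1 (ad0r ydM) !scaler0.
- by rewrite C21 h2 (ad0r ydM) !scaler0.
- by rewrite C21 adZ C21 h2 (ad0r ydM) !scaler0.
Qed.

(** Source of the sign change that separates N_1 from N_2. *)
Lemma diagonal_map (c : I -> K) : exists phi : 'End(V),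
  forall i, phi (x i) = c i *: x i.
Proof.
have fx : free (codom x) := basis_free x_basis.
have [phi] := linear_of_free (codom x) (codom (fun i => c i *: x i)).
move/(_ fx); rewrite !size_codom => /(_ erefl) E.
exists (linfun phi) => i; rewrite lfunE /=.
by move: E; rewrite /codom /image_mem -map_comp => /eq_in_map/(_ i (mem_enum _ i)).
Qed.

Lemma adsp_lines k l z :
  adsp <[x k]>%VS (nichols_im M <[x l]>%VS) z -> exists a, z = a *: ad (x k) (X l).
Proof.
move: z; apply: adsp_ind => [|_ _ /vlineP[a ->] [_ /vlineP[b ->] ->]].
  split=> [|a _ _ [b ->] [c ->]]; first by exists 0; rewrite scale0r.
  by exists (a * b + c); rewrite scalerDl scalerA.
exists (a * b); rewrite -[a *: _]addr0 adDl ad0l addr0 linearZ /=.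
by rewrite -[b *: _]addr0 (adDr ydM) (ad0r ydM) addr0 scalerA.
Qed.

(* The involution x_l1 |-> - x_l1 acts by -1 on the first line and trivially on *)
(* the second one.                                                              *)
Lemma adsp_lines_cap k1 k2 l1 l2 : (2%:R : K) != 0 ->
  l1 != k1 -> l1 != k2 -> l1 != l2 ->
  (adsp <[x k1]>%VS (nichols_im M <[x l1]>%VS) `&`
   adsp <[x k2]>%VS (nichols_im M <[x l2]>%VS) = [set 0])%classic.
Proof.
move=> K2 lk1 lk2 ll; apply/seteqP; split=> [z []|_ ->]; last first.
  by split; exact: (lspan_closed _).1.
move=> /adsp_lines[a ->] /adsp_lines[b].
have [phi phiE] := diagonal_map (fun i => if i == l1 then -1 else 1).
have phi_l1 : phi (x l1) = - x l1 by rewrite phiE eqxx scaleN1r.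
have phi_ne i : l1 != i -> phi (x i) = x i.
  by move=> ne; rewrite phiE eq_sym (negbTE ne) scale1r.
have phiK v : phi (phi v) = v.
  move: v; apply: x_basis_ind => [|i]; first split=> [|c u v hu hv].
  - by rewrite !linear0.
  - by rewrite !linearP /= hu hv.
  by rewrite phiE linearZ /= phiE scalerA; case: eqP; rewrite ?mulrNN mulr1 scale1r.
have phi_act g v : phi (ydact M g v) = ydact M g (phi v).
  move: v; apply: x_basis_ind => [|i]; first split=> [|c u v hu hv].
  - by rewrite !linear0.
  - by rewrite !linearP /= hu hv.
  by rewrite [in RHS]phiE [RHS]linearZ /= !x_act [LHS]linearZ /= phiE !scalerA mulrC.
have gM := is_yd_graded ydM.
have phi_proj g v : phi (ydproj M g v) = ydproj M g (phi v).
  move: v; apply: x_basis_ind => [|i]; first split=> [|c u v hu hv].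
  - by rewrite !linear0.
  - by rewrite !linearP /= hu hv.
  rewrite phiE linearZ /= !(ydproj_deg gM _ (x_deg i)).
  by case: (g == gb i); rewrite ?phiE // linear0 scaler0.
have phi_deg g v : v \in yddeg M g -> phi v \in yddeg M g.
  move=> vg; have := ydproj_deg gM g vg; rewrite eqxx => <-.
  by rewrite phi_proj; apply: ydproj_mem.
pose t k l : tensor V :=
  tens_in (x k) * tens_in (x l) - q k l *: (tens_in (x l) * tens_in (x k)).
have tE k l : ad (x k) (X l) = nichols_pi M (t k l).
  by rewrite ad_X /t linearB [in RHS]linearZ /= !rmorphM.
have phi1 : tens_map phi (t k1 l1) = - t k1 l1.
  rewrite /t linearB [in LHS]linearZ /= !rmorphM /= !tens_map_in /= phi_l1 phi_ne //.
  by rewrite linearN /= mulrN mulNr scalerN -opprD.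
have phi2 : tens_map phi (t k2 l2) = t k2 l2.
  by rewrite /t linearB [in LHS]linearZ /= !rmorphM /= !tens_map_in /= !phi_ne.
rewrite !tE -!linearZ => E.
(* A common element y of the two lines satisfies y = -y after the sign change, and 2 is
   invertible. *)
have : tens_map phi (a *: t k1 l1 - b *: t k2 l2) \in nichols_ideal M.
  by apply: (nichols_invol_ideal phiK phi_act phi_deg); apply/nichols_piP.
rewrite linearB /= [tens_map phi (a *: _)]linearZ [tens_map phi (b *: _)]linearZ /=.
rewrite phi1 phi2 scalerN => /nichols_piP; rewrite -E linearN.
move/eqP; rewrite eq_sym -subr_eq0 opprK -mulr2n.
by rewrite -scaler_nat scaler_eq0 (negbTE K2) => /eqP.
Qed.

(** Four brackets of basis vectors span the left side, and the two crossed ones are zero. *)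
Lemma adsp_split k1 k2 l1 l2 :
  ad (x k1) (X l2) = 0 -> ad (x k2) (X l1) = 0 ->
  adsp (S [set k1; k2]) (nichols_im M (S [set l1; l2])) =
  [set y1 + y2 | y1 in adsp <[x k1]>%VS (nichols_im M <[x l1]>%VS)
               & y2 in adsp <[x k2]>%VS (nichols_im M <[x l2]>%VS)]%classic.
Proof.
move=> h12 h21.
have sub (N N' : {vspace V}) L L' : (N <= N')%VS -> (L `<=` L')%classic ->
    (adsp (M := M) N L `<=` adsp N' L')%classic.
  move=> NN LL; apply: adsp_ind => [|v y Nv Ly]; first exact: lspan_closed.
  by apply: adsp_mem; [apply: (subvP NN)|apply: LL].
have subS (A : {set I}) i : i \in A -> (<[x i]> <= S A)%VS.
  by move=> iA; apply: (sumv_sup i).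
have mem k l : adsp <[x k]>%VS (nichols_im M <[x l]>%VS) (ad (x k) (X l)).
  by apply: adsp_mem; [apply: memv_line|exists (x l) => //; apply: memv_line].
set N1 := adsp <[x k1]>%VS _; set N2 := adsp <[x k2]>%VS _.
have [z1 D1] : lclosed N1 := lspan_closed _.
have [z2 D2] : lclosed N2 := lspan_closed _.
apply/seteqP; split.
  apply: (@adspn_ind 1) => [|[|k []] //= l _ kA lB].
    split=> [|a _ _ [u1 hu1 [u2 hu2 <-]] [v1 hv1 [v2 hv2 <-]]].
      by exists 0 => //; exists 0 => //; rewrite addr0.
    exists (a *: u1 + v1); first exact: D1.
    by exists (a *: u2 + v2); [exact: D2|rewrite scalerDr addrACA].
  have /set2P := kA k (mem_head _ _); move/set2P: lB.
  move=> [] -> [] ->.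
  - by exists (ad (x k1) (X l1)); [exact: mem|exists 0; rewrite ?addr0].
  - by rewrite h21; exists 0 => //; exists 0; rewrite ?addr0.
  - by rewrite h12; exists 0 => //; exists 0; rewrite ?addr0.
  - by exists 0 => //; exists (ad (x k2) (X l2)); [exact: mem|rewrite add0r].
move=> _ [u1 hu1 [u2 hu2 <-]].
have [zS DS] : lclosed (adsp (S [set k1; k2]) (nichols_im M (S [set l1; l2]))) :=
  lspan_closed _.
rewrite -[u1]scale1r; apply: DS.
  apply: sub hu1; first by rewrite subS ?set21.
  by move=> _ [v /(subvP (subS [set l1; l2] _ (set21 _ _))) hv ->]; exists v.
apply: sub hu2; first by rewrite subS ?set22.
by move=> _ [v /(subvP (subS [set l1; l2] _ (set22 _ _))) hv ->]; exists v.
Qed.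

End Diagonal.

(** * Comparison of the Cartan matrices of M and of its covering module *)

Theorem theorem3p15 (R : realType)
  (* Gamma, Sigma = Z_2 and the stem extension *)
  (Gam Sigma G : finGroupType)
  (Gam_abelian : abelian [set: Gam])
  (Sigma_Z2 : #|[set: Sigma]| = 2%N)
  (E : stem_ext Sigma Gam G R[i])
  (* M = (+)_i x_i C *)
  (V : vectType R[i]) (M : yd Gam V)
  (M_yd : is_yd M)
  (M_indecomposable : yd_indecomposable M)
  (I : finType) (x : I -> V)
  (x_basis : basis_of fullv (codom x))
  (gb : I -> Gam) (chi : I -> dual Gam R[i])
  (x_deg : forall i, x i \in yddeg M (gb i))
  (x_act : forall i g, ydact M g (x i) = chi i g *: x i)
  (M_noniso : forall i j, i != j -> ~ yd_iso M <[x i]>%VS <[x j]>%VS)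
  (M_findim : findim (nichols M))
  (* Sigma acts as twisted permutation symmetries *)
  (to : {action Sigma &-> I}) (f : Sigma -> 'End(V))
  (f_symm : twisted_symm E M x gb to f) :
  let Mt := covering E M f in
  let It := [set orbit to [set: Sigma] i | i in I]%SET in
  let q i j := chi j (gb i) in
  let Ms (i : I) : {vspace V} := <[x i]>%VS in
  let Mts (kt : {set I}) : {vspace V} := (\sum_(k in kt) Ms k)%VS in
  let C := cartan M Ms in
  let Ct := cartan Mt Mts in
  forall kt lt : {set I}, kt \in It -> lt \in It -> kt != lt ->
  [/\ (* (1) disconnected *)
      (forall k l, k \in kt -> l \in lt ->
         q k l * q l k = 1 /\ ad (x k) (nichols_in M (x l)) = 0) ->
      Ct kt lt = 0 /\ Ct lt kt = 0,
      (* (2) inert edge *)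
      forall k l, kt = [set k]%SET -> lt = [set l]%SET ->
      Ct kt lt = C k l,
      (* (3) split edge *)
      forall k1 k2 l1 l2,
      kt = [set k1; k2]%SET -> k1 != k2 -> lt = [set l1; l2]%SET -> l1 != l2 ->
      let N1 := adsp (Ms k1) (nichols_im M (Ms l1)) in
      let N2 := adsp (Ms k2) (nichols_im M (Ms l2)) in
      cartan_sub C [tuple k1; l1; k2; l2] =
        mx_of_rows 4 [:: [:: 2; -1;  0;  0];
                         [::-1;  2;  0;  0];
                         [:: 0;  0;  2; -1];
                         [:: 0;  0; -1;  2]] ->
      N1 <> [set 0]%classic -> N2 <> [set 0]%classic ->
      (exists Phi : {lrmorphism nichols M -> nichols Mt},
         [/\ bijective Phi,
             forall v, Phi (nichols_in M v) = nichols_in Mt v,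
             adsp (Mts kt) (nichols_im Mt (Mts lt)) =
               [set y1 + y2 | y1 in Phi @` N1 & y2 in Phi @` N2]%classic &
             (Phi @` N1 `&` Phi @` N2 = [set 0])%classic]) /\
      cartan_sub Ct [tuple kt; lt] =
        mx_of_rows 2 [:: [:: 2; -1];
                         [::-1;  2]] &
      (* (4) ramified edge *)
      forall k1 k2 l,
      kt = [set k1; k2]%SET -> k1 != k2 -> lt = [set l]%SET ->
      let N1 := adsp (Ms k1) (nichols_im M (Ms l)) in
      let N2 := adsp (Ms k2) (nichols_im M (Ms l)) in
      cartan_sub C [tuple k1; l; k2] =
        mx_of_rows 3 [:: [:: 2; -1;  0];
                         [::-1;  2; -1];
                         [:: 0; -1;  2]] ->
      N1 <> [set 0]%classic -> N2 <> [set 0]%classic ->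
      adsp (Ms k2) N1 = adsp (Ms k1) N2 ->
      adsp (Ms k2) N1 <> [set 0]%classic ->
      cartan_sub Ct [tuple kt; lt] =
        mx_of_rows 2 [:: [:: 2; -2];
                         [::-1;  2]]].
Proof.
move=> Mt It q Ms Mts C Ct kt lt ktI ltI ktlt.
have inh (A : {set I}) : A \in It -> exists k, k \in A.
  by case/imsetP => k _ ->; exists k; apply: orbit_refl.
have K2 : (2%:R : R[i]) != 0 by rewrite Num.Theory.pnatr_eq0.
have fx p i : f p (x i) = x (to i p) := symm_basis f_symm p i.
have f1 v : f 1%g v = v.
  move: v; apply: (x_basis_ind x_basis) => [|i]; last by rewrite fx act1.
  by split=> [|a u v hu hv]; rewrite ?linear0 // linearP /= hu hv.
have ff p v : f p (f p v) = v.
  move: v; apply: (x_basis_ind x_basis) => [|i]; last first.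
    by rewrite !fx -actM (Z2_sqr Sigma_Z2) act1.
  by split=> [|a u v hu hv]; rewrite ?linear0 // !linearP /= hu hv.
have gMt : graded Mt := covering_graded E Sigma_Z2 K2 M_yd f1 ff (symm_graded f_symm).
have act' h : ydact Mt h = ydact M (ext_proj E h) by [].
have deg' h : (yddeg Mt h <= yddeg M (ext_proj E h))%VS by apply: capvSl.
(* From here on the entries of [Ct] are computed in B(M). *)
have CtE A B m : A != B -> is_max_ad M (Mts A) (Mts B) m -> Ct A B = - m%:Z.
  move=> AB hm; rewrite /Ct (refine_cartan M_yd gMt act' deg').
  exact: is_max_ad_cartan.
have CE k l m : k != l -> C k l = - m%:Z ->
    adw x (nseq m k) (nichols_in M (x l)) <> 0 /\
    adw x (nseq m.+1 k) (nichols_in M (x l)) = 0.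
  by move=> kl /(cartan_is_max_ad kl)/(is_max_adE M_yd).
(* Diagonal entries are 2 by definition, so any other value certifies distinct indices. *)
have C_neq k l c : C k l = c -> c != 2 -> k != l.
  by move=> <-; apply: contraNneq => ->; rewrite /C /cartan eqxx.
have C0 k l : C k l = 0 -> ad (x k) (nichols_in M (x l)) = 0.
  by move=> h; have [] := CE k l 0%N (C_neq k l _ h isT) h.
have C1 k l : C k l = -1 -> ad (x k) (nichols_in M (x l)) <> 0 /\
    ad (x k) (ad (x k) (nichols_in M (x l))) = 0.
  by move=> h; apply: (CE k l 1%N (C_neq k l _ h isT) h).
have Ct2 A B a b : A != B -> Ct A B = a -> Ct B A = b ->
    cartan_sub Ct [tuple A; B] = mx_of_rows 2 [:: [:: 2; a]; [:: b; 2]].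
  move=> AB Ea Eb; apply/matrixP => i j; rewrite !mxE !(tnth_nth A).
  by case: i j => [[|[|?]] ?] [[|[|?]] ?] //=; rewrite /Ct /cartan eqxx.
have ltkt : lt != kt by rewrite eq_sym.
split.
- move=> h; have [[k hk] [l hl]] := (inh _ ktI, inh _ ltI).
  split; [apply: (CtE _ _ 0%N) ktlt _|apply: (CtE _ _ 0%N) ltkt _].
    apply: (is_max_ad_disconnected M_yd x_basis x_deg hl) => i j ik jl.
    by have [] := h _ _ ik jl.
  apply: (is_max_ad_disconnected M_yd x_basis x_deg hk) => i j il jk.
  have [qq h0] := h _ _ jk il.
  exact: (ad_X_sym M_yd x_deg x_act qq h0).
- move=> k l Ek El; have kl : k != l by apply: contra_neq ktlt; rewrite Ek El => ->.
  (* The summand of an inert orbit is the line itself, so both entries are the same expression over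
     [M]. *)
  have MsE i : Mts [set i] = Ms i by rewrite /Mts big_set1.
  rewrite /Ct (refine_cartan M_yd gMt act' deg') /C /cartan (negbTE ktlt) (negbTE kl).
  by rewrite Ek El !MsE.
- move=> k1 k2 l1 l2 Ek k12 El l12 N1 N2 hC _ _.
  have e (a b : nat) (a4 : (a < 4)%N) (b4 : (b < 4)%N) :=
    cartan_sub_entry (Ordinal a4) (Ordinal b4) hC.
  have [n11 h11] := C1 k1 l1 (e 0 1 isT isT).
  have [n11' h11'] := C1 l1 k1 (e 1 0 isT isT).
  have [n22 h22] := C1 k2 l2 (e 2 3 isT isT).
  have [n22' h22'] := C1 l2 k2 (e 3 2 isT isT).
  have k12_0 := C0 k1 k2 (e 0 2 isT isT); have k21_0 := C0 k2 k1 (e 2 0 isT isT).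
  have l12_0 := C0 l1 l2 (e 1 3 isT isT); have l21_0 := C0 l2 l1 (e 3 1 isT isT).
  have k1l2 := C0 k1 l2 (e 0 3 isT isT); have l2k1 := C0 l2 k1 (e 3 0 isT isT).
  have k2l1 := C0 k2 l1 (e 2 1 isT isT); have l1k2 := C0 l1 k2 (e 1 2 isT isT).
  split; last first.
    apply: Ct2 => //; [apply: (CtE _ _ 1%N) ktlt _|apply: (CtE _ _ 1%N) ltkt _];
      by rewrite Ek El; apply: (is_max_ad_split M_yd x_deg x_act).
  have [Phi [bijPhi Phi_in Phi_ad]] := refine_lrmorphism M_yd gMt act' deg'.
  exists Phi; split=> //.
    rewrite Phi_ad Ek El (adsp_split M_yd k1l2 k2l1).
    apply/seteqP; split=> [_ [_ [u hu [v hv <-]] <-]|_ [_ [u hu <-] [_ [v hv <-] <-]]].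
      by exists (Phi u); [exists u|exists (Phi v); [exists v|rewrite linearD]].
    by exists (u + v); [exists u => //; exists v|rewrite linearD].
  (* [Phi] is injective, so the intersection may be computed in B(M). *)
  have cap := adsp_lines_cap M_yd x_basis x_deg x_act K2
    (C_neq l1 k1 _ (e 1 0 isT isT) isT) (C_neq l1 k2 _ (e 1 2 isT isT) isT) l12.
  rewrite -[RHS](_ : (Phi @` [set 0])%classic = _); last by rewrite image_set1 linear0.
  rewrite -cap; apply/seteqP; split=> [_ [[u hu <-] [v hv /(bij_inj bijPhi) vu]]|].
    by exists u => //; split=> //; rewrite -vu.
  by move=> _ [u [hu hv] <-]; split; exists u.
- move=> k1 k2 l Ek k12 El N1 N2 hC _ _ _ n0.
  have e (a b : nat) (a3 : (a < 3)%N) (b3 : (b < 3)%N) :=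
    cartan_sub_entry (Ordinal a3) (Ordinal b3) hC.
  have [n1 h1] := C1 k1 l (e 0 1 isT isT).
  have [n1' h1'] := C1 l k1 (e 1 0 isT isT).
  have [n2 h2] := C1 k2 l (e 2 1 isT isT).
  have [n2' h2'] := C1 l k2 (e 1 2 isT isT).
  have k12_0 := C0 k1 k2 (e 0 2 isT isT); have k21_0 := C0 k2 k1 (e 2 0 isT isT).
  apply: Ct2 => //; [apply: (CtE _ _ 2%N) ktlt _|apply: (CtE _ _ 1%N) ltkt _].
    rewrite Ek El.
    apply: (is_max_ad_ramified Gam_abelian M_yd x_basis x_deg x_act) => //.
    (* The space N_12 is spanned by this one bracket, so it would vanish with it. *)
    move=> k210; apply: n0.
    apply: adsp_eq0 => _ _ /vlineP[a ->] /(adsp_lines M_yd)[b ->].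
    rewrite -[a *: _]addr0 adDl ad0l addr0 -[b *: _]addr0 (adDr M_yd) k210.
    by rewrite (ad0r M_yd) scaler0 addr0 scaler0.
  (* In the other direction ad(x_l) squared kills both x_k1 and x_k2, so the entry is -1. *)
  rewrite Ek El.
  apply: (is_max_ad_simple M_yd (k := l) (l := k1)); rewrite ?set11 ?set21 //.
  by move=> i j k /set1P-> /set1P-> /set2P[]->.
Qed.
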